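(* Assume that the drift condition, the long-time contractivity condition, the minorization condition and the smallness condition (all stated in the context) hold. Then there exists a probability measure $\mu_*$ on $(\mathcal X,\mathcal B)$, independent of $x_0$, such that for every deterministic initial state $x_0\in\mathcal X$ and every process $(X_t)_{t\in\mathbb N}$ as in the context with $X_0=x_0$, the laws $\mu_N=\mathrm{Law}(X_N)$ satisfy $d_{TV}(\mu_N,\mu_* )\to 0$ as $N\to\infty$. More precisely, for every $1/2<\lambda<1$ there exist constants $c=c(\lambda)>0$ and $\nu=\nu(\lambda)>0$ (for the given process $X$) such that for all integers $N\ge 1$ $$d_{TV}(\mu_N,\mu_* )\le 2\sum_{n=N}^{\infty}\left[\mathbb E\left(\max_{0\le k<\lfloor n^{1/3}\rfloor^3}\alpha(Y_k)^{\lfloor n^{1/3}\rfloor-1}\right)+\bar\gamma^{\left(\lambda-\frac12\right)\lfloor n^{1/3}\rfloor^2-n^{1/3}}+c\,n^{2/3}e^{-\nu n^{1/3}}\right].$$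
   Context: Let $(\Omega,\mathcal F,\mathbb P)$ be a probability space, $(\mathcal X,\mathcal B)$ a standard Borel space, $(\mathcal Y,\mathcal A)$ a measurable space, and $Y=(Y_t)_{t\in\mathbb Z}$ a strictly stationary $\mathcal Y$-valued process on $\Omega$ (the environment). Let $Q:\mathcal Y\times\mathcal X\times\mathcal B\to[0,1]$ be such that $(y,x)\mapsto Q(y,x,B)$ is $\mathcal A\otimes\mathcal B$-measurable for each $B\in\mathcal B$ and $Q(y,x,\cdot)$ is a probability measure for each $(y,x)$. For nonnegative measurable $\phi$ put $[Q(y)\phi](x)=\int_{\mathcal X}\phi(z)\,Q(y,x,dz)$. The process $X=(X_t)_{t\in\mathbb N}$ is $\mathcal X$-valued, $X_0=x_0$ is deterministic, and $\mathbb P(X_{t+1}\in B\mid\mathcal F_t)=Q(Y_t,X_t,B)$ a.s. for all $t\in\mathbb N$, $B\in\mathcal B$, where $\mathcal F_t=\sigma(X_s,0\le s\le t;\ Y_s,s\in\mathbb Z)$. $\mu_t$ denotes the law of $X_t$. $d_{TV}(\mu_1,\mu_2)=|\mu_1-\mu_2|(\mathcal X)$ is the total mass of the total variation measure of $\mu_1-\mu_2$ (so it takes values in $[0,2]$). Drift condition: there are a measurable $V:\mathcal X\to[0,\infty)$ and measurable $\gamma:\mathcal Y\to(0,\infty)$, $K:\mathcal Y\to[1,\infty)$ with $[Q(y)V](x)\le\gamma(y)V(x)+K(y)$ for all $x\in\mathcal X,y\in\mathcal Y$. Long-time contractivity condition: $\bar\gamma:=\limsup_{n\to\infty}\left(\mathbb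 E\left[K(Y_0)\prod_{k=1}^n\gamma(Y_k)\right]\right)^{1/n}<1$. Minorization condition: for some $0<\epsilon<1/\bar\gamma^{1/2}-1$ (so implicitly $\bar\gamma>0$) there are a measurable $\alpha:\mathcal Y\to[0,1)$ and a probability kernel $\kappa:\mathcal Y\times\mathcal B\to[0,1]$ such that for all $y\in\mathcal Y$, $A\in\mathcal B$: $\inf_{x\in V^{-1}([0,R(y)])}Q(y,x,A)\ge(1-\alpha(y))\kappa(y,A)$, where $R(y)=\frac{2K(y)}{\epsilon\gamma(y)}$, and $V^{-1}([0,R(y)])\ne\emptyset$. Smallness condition: there is $0<\theta<1$ with $\lim_{n\to\infty}\left(\mathbb E[\alpha(Y_0)^n]\right)^{1/n^\theta}=0$. *)

(* Defs.v *)
(* MathComp-Analysis; the real numbers are an arbitrary [R : realType]. *)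
From HB Require Import structures.
From mathcomp Require Import all_boot all_order all_algebra.
From mathcomp Require Import all_classical all_reals all_analysis measurable_realfun.

Set Implicit Arguments.
Unset Strict Implicit.
Unset Printing Implicit Defensive.

Import Order.TTheory GRing.Theory Num.Theory.
Import numFieldNormedType.Exports.

Local Open Scope classical_set_scope.
Local Open Scope ring_scope.
Local Open Scope ereal_scope.

(* Isomorphic, as a measurable space, to a Polish space with its Borel
   sigma-algebra. A Hausdorff complete pseudometric space is a complete metric
   space. *)
Definition standard_borel (R : realType) d (T : measurableType d) : Prop :=
  exists (S : completePseudoMetricType R) (f : T -> S),
    [/\ hausdorff_space S,
        (exists2 D : set S, countable D & dense D),
        bijective f &
        forall A : set T, measurable A <-> <<s @open S >> (f @` A)].

Definition total_variation_mass (R : realType) d (T : measurableType d)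
    (nu : {charge set T -> \bar R}) : \bar R :=
  charge_variation
    (svalP (cid (svalP (cid (Hahn_decomposition nu))))) [set: T].

Lemma total_variation_massE (R : realType) d (T : measurableType d)
    (nu : {charge set T -> \bar R}) (A B : set T)
    (nuAB : hahn_decomposition nu A B) :
  total_variation_mass nu = charge_variation nuAB [set: T].
Proof.
rewrite /total_variation_mass.
case: cid => P nuP /=; case: cid => N nuPN /=.
have := Hahn_decomposition_uniq nuAB nuPN measurableT.
rewrite /charge_variation /= !jordan_posE !jordan_negE.
rewrite !cjordan_posE !cjordan_negE /crestr0 !mem_set//.
by rewrite /crestr /= => -[-> ->].
Qed.

Definition dTV (R : realType) d (T : measurableType d)
    (mu1 mu2 : probability T R) : \bar R :=
  total_variation_mass
    (cadd (charge_of_finite_measure mu1) (copp (charge_of_finite_measure mu2))).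

Definition strictly_stationary (R : realType) d (Omega : measurableType d)
    (P : probability Omega R) dY (TY : measurableType dY)
    (Y : int -> {mfun Omega >-> TY}) : Prop :=
  forall (n : nat) (t : 'I_n -> int) (h : int) (A : set (n.-tuple TY)),
    measurable A ->
    pushforward P (fun w => [tuple Y (t i + h)%R w | i < n]) A =
    pushforward P (fun w => [tuple Y (t i) w | i < n]) A.

(* [f] is a version of P(E | G), for a sub-sigma-algebra [G]. *)
Definition cond_probability (R : realType) d (Omega : measurableType d)
    (P : probability Omega R) (G : set (set Omega)) (E : set Omega)
    (f : Omega -> \bar R) : Prop :=
  (forall B : set (\bar R), measurable B -> G (f @^-1` B)) /\
  (forall A, G A -> \int[P]_(w in A) f w = P (A `&` E)).

Definition history d (Omega : measurableType d)
    dX (TX : measurableType dX) dY (TY : measurableType dY)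
    (X : nat -> {mfun Omega >-> TX}) (Y : int -> {mfun Omega >-> TY}) (t : nat) :
    set (set Omega) :=
  <<s \bigcup_(s in [set s | (s <= t)%N])
        preimage_set_system setT (X s) measurable `|`
      \bigcup_s preimage_set_system setT (Y s) measurable >>.

(* Since [Q (Y_t, X_t) B] is [history X Y t]-measurable, being almost surely
   equal to the conditional probability means being a version of it. *)
Definition chain_in_random_environment (R : realType) d
    (Omega : measurableType d) (P : probability Omega R)
    dX (TX : measurableType dX) dY (TY : measurableType dY)
    (Q : R.-pker (TY * TX) ~> TX) (Y : int -> {mfun Omega >-> TY})
    (x0 : TX) (X : nat -> {mfun Omega >-> TX}) : Prop :=
  (forall w, X 0%N w = x0) /\
  (forall (t : nat) (B : set TX), measurable B ->
     cond_probability P (history X Y t) (X t.+1 @^-1` B)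
       (fun w => Q (Y (Posz t) w, X t w) B)).

Definition drift_condition (R : realType)
    dX (TX : measurableType dX) dY (TY : measurableType dY)
    (Q : R.-pker (TY * TX) ~> TX) (V : TX -> R) (gamma K : TY -> R) : Prop :=
  [/\ measurable_fun setT V /\ (forall x, 0 <= V x)%R,
      measurable_fun setT gamma /\ (forall y, 0 < gamma y)%R,
      measurable_fun setT K /\ (forall y, 1 <= K y)%R &
      forall (x : TX) (y : TY),
        \int[Q (y, x)]_z (V z)%:E <= (gamma y * V x + K y)%:E].

Definition gammabar (R : realType) d (Omega : measurableType d)
    (P : probability Omega R) dY (TY : measurableType dY)
    (Y : int -> {mfun Omega >-> TY}) (gamma K : TY -> R) : \bar R :=
  limn_esup (fun n : nat =>
    'E_P[fun w => (K (Y 0 w) *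
                   \prod_(1 <= k < n.+1) gamma (Y (Posz k) w))%R]
      `^ (n%:R^-1)%R).

Definition minorization_condition (R : realType)
    dX (TX : measurableType dX) dY (TY : measurableType dY)
    (Q : R.-pker (TY * TX) ~> TX) (V : TX -> R) (gamma K : TY -> R)
    (gbar eps : R) (alpha : TY -> R) (kappa : R.-pker TY ~> TX) : Prop :=
  let level y := V @^-1` `[0%R, (2 * K y / (eps * gamma y))%R]%classic in
  [/\ (0 < gbar)%R /\ (0 < eps < 1 / Num.sqrt gbar - 1)%R,
      measurable_fun setT alpha /\ (forall y, 0 <= alpha y < 1)%R,
      (forall y (A : set TX), measurable A ->
         (1 - alpha y)%:E * kappa y A <=
         ereal_inf [set Q (y, x) A | x in level y]) &
      forall y, level y !=set0].

Definition smallness_condition (R : realType) d (Omega : measurableType d)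
    (P : probability Omega R) dY (TY : measurableType dY)
    (Y : int -> {mfun Omega >-> TY}) (alpha : TY -> R) : Prop :=
  exists2 theta : R, (0 < theta < 1)%R &
    'E_P[fun w => (alpha (Y 0 w) ^+ n)%R] `^ (n%:R `^ theta)^-1%R
      @[n --> \oo] --> (0 : \bar R).

Definition floor_cbrt (R : realType) (n : nat) : nat :=
  Num.truncn (n%:R `^ 3^-1 : R)%R.

(* Main.v *)
(* By stationarity, X_(n+1) may be started at time -1: the laws of X_n and
   X_(n+1) are then averages, over the same environment Y_0 ... Y_(n-1), of
   Q(Y_0) ... Q(Y_(n-1)) started from x0 and from Q(Y_(-1)) x0. Cut m^3 <= n
   steps into m blocks of length m^2. For a fixed environment the oscillation of
   x |-> Q(y_0) ... Q(y_(n-1)) 1_A (x) is at most a^m + A (V x + V x') + B: each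
   block in which a pair of copies meets the level set V <= R(y) contributes a
   factor a = max alpha, and the affine terms pay for the blocks in which it does
   not. Since functions affine in V are propagated by the drift condition alone,
   no coupling has to be constructed. Averaging over the environment, A and B are
   of order ((1 + eps) r)^(m^2) for some r > gbar with (1 + eps) r < 1, which is
   absorbed by the term c n^(2/3) exp(- nu n^(1/3)). The smallness condition makes
   the bounds summable, so the laws converge uniformly on measurable sets. *)
Require Import Defs.
From HB Require Import structures.
From mathcomp Require Import all_boot all_order all_algebra.
From mathcomp Require Import all_classical all_reals all_analysis measurable_realfun.
From mathcomp Require Import ring lra.

Set Implicit Arguments.
Unset Strict Implicit.
Unset Printing Implicit Defensive.

Import Order.TTheory GRing.Theory Num.Theory.
Import numFieldNormedType.Exports.

Local Open Scope classical_set_scope.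
Local Open Scope ring_scope.
Local Open Scope ereal_scope.

(** * Kernels and disintegration *)

(** For a single environment nothing need contract: [gamma] may exceed 1 for a long time, and only
    averages decay. Hence the oscillation bound keeps its coefficients A and B as explicit functions
    of the environment, and the mean is taken only at the end. At that point the starting law
    [Q(Y_(-1)) x0] is correlated with the environment that multiplies it, so expectations do not
    factor. What saves the argument is that every random term is [K] at one time multiplied by
    [gamma] at consecutive later times, or is dominated by such a product. By stationarity its mean
    is E[K(Y_0) gamma(Y_1) ... gamma(Y_q)], exactly the quantity in the contractivity condition. The
    bound on eps gives (1 + eps) gbar < sqrt gbar < 1, which leaves room for an r strictly between
    gbar and 1 / (1 + eps). The moment bound by r^q holds only from some q on; for the remaining n
    the constant c is made so large that the estimate is trivial. The value of c also depends on V
    at the starting point, which is why each chain has its own constants although the limit is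
    common. *)

Section kernel_pullback.
Context d d1 d2 (Z : measurableType d) (X : measurableType d1)
  (T : measurableType d2) (R : realType) (k : R.-pker X ~> T) (f : Z -> X).

(** The measurability proof is an argument, although the body ignores it, so that the kernel and
    probability kernel structures can be attached to the term. *)
Definition kernel_pullback (mf : measurable_fun setT f) (z : Z) :
  {measure set T -> \bar R} := k (f z).

Hypothesis mf : measurable_fun setT f.

Let measurable_kernel_pullback U : measurable U ->
  measurable_fun setT (kernel_pullback mf ^~ U).
Proof.
by move=> mU; apply: (measurableT_comp (measurable_kernel k U mU)).
Qed.

HB.instance Definition _ := isKernel.Build _ _ _ _ _ (kernel_pullback mf)
  measurable_kernel_pullback.

Let kernel_pullback_prob z : kernel_pullback mf z setT = 1.
Proof. exact: prob_kernel. Qed.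

HB.instance Definition _ := Kernel_isProbability.Build _ _ _ _ _
  (kernel_pullback mf) kernel_pullback_prob.

End kernel_pullback.

Section kernel_graph.
Context d d1 d2 (Z : measurableType d) (E : measurableType d1)
  (T : measurableType d2) (R : realType) (k : R.-pker Z ~> T) (u : Z -> E).

(** The law of [(u z, x)] with [x] drawn from [k z]. It reduces integrands that depend on the source
    point through [u] to plain kernel integrals, from which joint measurability follows. *)
Definition kernel_graph (mu : measurable_fun setT u) (z : Z) :
    {measure set (E * T)%type -> \bar R} :=
  measure_function_pushforward__canonical__measure_function_Measure
    (k z) (pair1_measurable (u z)).

Hypothesis mu : measurable_fun setT u.

Lemma integral_kernel_graph z (f : (E * T)%type -> \bar R) :
  measurable_fun setT f -> (forall p, 0 <= f p) ->
  \int[kernel_graph mu z]_p f p = \int[k z]_x f (u z, x).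
Proof.
move=> mf f0; exact: ge0_integral_pushforward.
Qed.

Let measurable_kernel_graph U : measurable U ->
  measurable_fun setT (kernel_graph mu ^~ U).
Proof.
move=> mU.
pose V : set (Z * T) := (fun p : Z * T => (u p.1, p.2)) @^-1` U.
have mV : measurable V.
  rewrite -[V]setTI; apply: (_ : measurable_fun _ _) => //.
  apply/measurable_fun_pairP; split => /=.
    exact: (measurableT_comp mu).
  exact: measurable_snd.
have := @measurable_fun_xsection_finite_kernel _ _ _ _ _ k V.
rewrite inE => /(_ mV); congr (measurable_fun _ _); apply/funext => z.
by congr (k z _); apply/funext => x; rewrite /xsection /= inE.
Qed.

HB.instance Definition _ := isKernel.Build _ _ _ _ _ (kernel_graph mu)
  measurable_kernel_graph.

Let kernel_graph_prob z : kernel_graph mu z setT = 1.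
Proof. exact: prob_kernel. Qed.

HB.instance Definition _ := Kernel_isProbability.Build _ _ _ _ _
  (kernel_graph mu) kernel_graph_prob.

End kernel_graph.

Lemma measurable_integral_graph d d1 d2 (Z : measurableType d)
    (E : measurableType d1) (T : measurableType d2) (R : realType)
    (k : R.-pker Z ~> T) (u : Z -> E) (f : (E * T)%type -> \bar R) :
  measurable_fun setT u -> measurable_fun setT f -> (forall p, 0 <= f p) ->
  measurable_fun setT (fun z => \int[k z]_x f (u z, x)).
Proof.
move=> mu mf f0.
under eq_fun do rewrite -(integral_kernel_graph k mu)//.
apply: measurable_fun_integral_kernel => // U mU.
exact: (measurable_kernel (kernel_graph k mu)).
Qed.

Section disintegration.
Context d dE dT (Omega : measurableType d) (E : measurableType dE)
  (T : measurableType dT) (R : realType) (P : probability Omega R)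
  (U : {mfun Omega >-> E}) (X : {mfun Omega >-> T}) (k : R.-pker Omega ~> T).

Let constP : R.-pker unit ~> Omega := kprobability (measurable_cst (P : pprobability Omega R)).

(** Both sides integrate [f] against a probability on the product: the law of [(U, X)], and the law
    of [(U w, x)] with [w] drawn from [P] and [x] from [k w]. The hypothesis says that they agree on
    rectangles, a generating pi-system. *)
Lemma integral_disintegration (f : (E * T)%type -> \bar R) :
  (forall A B, measurable A -> measurable B ->
    P (U @^-1` A `&` X @^-1` B) = \int[P]_(w in U @^-1` A) k w B) ->
  measurable_fun setT f -> (forall p, 0 <= f p) ->
  \int[P]_w f (U w, X w) = \int[P]_w \int[k w]_x f (U w, x).
Proof.
move=> UX mf f0.
have mk : measurable_fun setT (@snd unit Omega) by exact: measurable_snd.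
have mUs : measurable_fun setT (U \o @snd unit Omega) by exact: measurableT_comp.
pose K := kernel_graph (kernel_pullback k mk) mUs.
have -> : \int[P]_w \int[k w]_x f (U w, x) = \int[kcomp constP K tt]_p f p.
  rewrite integral_kcomp//; apply: eq_integral => w _.
  by rewrite integral_kernel_graph.
have mUX : measurable_fun setT (fun w => (U w, X w)).
  exact: measurable_fun_pair.
rewrite -[LHS](@ge0_integral_pushforward _ _ _ _ _ _ mUX P setT f)//.
apply: eq_measure_integral => A mA _.
pose G := [set A `*` B | A in @measurable _ E & B in @measurable _ T].
apply: (measure_unique G (fun=> setT)) => //.
- exact: measurable_prod_measurableType.
- move=> _ _ [A1 mA1 [B1 mB1 <-]] [A2 mA2 [B2 mB2 <-]].
  exists (A1 `&` A2); first exact: measurableI.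
  by exists (B1 `&` B2); [exact: measurableI | rewrite setXI].
- by move=> _; exists setT => //; exists setT => //; rewrite setXTT.
- by rewrite bigcup_const.
- move=> _ [A1 mA1 [B1 mB1 <-]].
  transitivity (P (U @^-1` A1 `&` X @^-1` B1)); first by [].
  rewrite UX//= /kcomp [LHS]integral_mkcond; apply: eq_integral => w _.
  rewrite /kernel_graph /pushforward/= /kernel_pullback patchE.
  case: ifPn => Uw.
    congr (k w _); apply/seteqP; split => x //=; last by case.
    by rewrite inE in Uw.
  rewrite -[LHS](measure0 (k w)); congr (k w _).
  by apply/seteqP; split => x //= -[]; rewrite notin_setE in Uw.
- by move=> _; rewrite [X in X < _](_ : _ = P setT) // probability_setT ltry.
Qed.

End disintegration.

(** * Quenched transition probabilities *)

Section quenched_transition.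
Context dX dY (TX : measurableType dX) (TY : measurableType dY) (R : realType).
Variable Q : R.-pker (TY * TX) ~> TX.

(* [quenched A n y x] is [Q(y_0) ... Q(y_{n-1}) 1_A (x)]. *)
Fixpoint quenched (A : set TX) (n : nat) (y : nat -> TY) (x : TX) : \bar R :=
  if n is m.+1 then \int[Q (y 0%N, x)]_z quenched A m (y \o S) z
  else (\1_A x)%:E.

Lemma quenched_ge0 A n y x : 0 <= quenched A n y x.
Proof.
elim: n y x => [|n IHn] y x /=; first by rewrite lee_fin.
exact: integral_ge0.
Qed.

(** The environment is read off an arbitrary parameter space [W]: a point, [Omega], [Omega] with the
    sigma-algebra of the environment, or a space of tuples. *)
Lemma measurable_quenched_env d (W : measurableType d) A n (c : nat -> W -> TY) :
  measurable A -> (forall k, measurable_fun setT (c k)) ->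
  measurable_fun setT (fun p : W * TX => quenched A n (c ^~ p.1) p.2).
Proof.
move=> mA; elim: n c => [|n IHn] c mc /=.
  apply/measurable_EFinP; apply: measurableT_comp => //.
have mf : measurable_fun setT (fun p : W * TX => (c 0%N p.1, p.2)).
  by apply: measurable_fun_pair => //; exact: measurableT_comp.
apply: (measurable_integral_graph (kernel_pullback Q mf) (u := @fst W TX)
  (f := fun p => quenched A n ((fun k => c k.+1) ^~ p.1) p.2)) => //.
  exact: (IHn (fun k => c k.+1)).
by move=> p; exact: quenched_ge0.
Qed.

Lemma measurable_quenched A n y :
  measurable A -> measurable_fun setT (quenched A n y).
Proof.
move=> mA.
have mfp := @measurable_quenched_env _ unit A n (fun k _ => y k) mA
  (fun=> measurable_cst _).
exact: (measurableT_comp mfp (pair1_measurable tt)).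
Qed.

Lemma quenched_le1 A n y x : measurable A -> quenched A n y x <= 1.
Proof.
move=> mA; elim: n y x => [|n IHn] y x /=.
  by rewrite lee_fin indicE; case: (_ \in _).
rewrite -(prob_kernel (s := Q) (y 0%N, x)) -[leRHS]mul1e -integral_cst//.
apply: ge0_le_integral => //.
- by move=> z _; exact: quenched_ge0.
- exact: measurable_quenched.
Qed.

Lemma quenched_fin_num A n y x :
  measurable A -> quenched A n y x \is a fin_num.
Proof.
move=> mA; rewrite ge0_fin_numE ?quenched_ge0//.
exact: le_lt_trans (quenched_le1 n y x mA) (ltry 1).
Qed.

Lemma eq_quenched A n y1 y2 x : (forall k, (k < n)%N -> y1 k = y2 k) ->
  quenched A n y1 x = quenched A n y2 x.
Proof.
elim: n y1 y2 x => [//|n IHn] y1 y2 x y12 /=; rewrite y12//.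
by apply: eq_integral => z _; apply: IHn => k kn /=; exact: y12.
Qed.

Context d (Omega : measurableType d) (P : probability Omega R).
Variables (Y : int -> {mfun Omega >-> TY}).

(** The induction is on the number of steps left, from an arbitrary time [t]: one disintegration
    replaces a transition out of [X t] by [X t.+1]. The integrand involves future values of the
    environment, which is legitimate because the history contains the whole of [Y]. *)
Lemma law_quenched x0 X A n : measurable A ->
  chain_in_random_environment P Q Y x0 X ->
  distribution P (X n) A =
  \int[P]_w quenched A n (fun k => Y (Posz k) w) x0.
Proof.
move=> mA [X0 condX].
pose sY := \bigcup_s preimage_set_system setT (Y s) (@measurable _ TY).
(* [Omega] with the sigma-algebra generated by the whole environment; [U] below is the identity into
   it. *)
pose E := g_sigma_algebraType sY.
have subY (B : set Omega) : <<s sY >> B -> measurable B.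
  apply: smallest_sub; first exact: sigma_algebra_measurable.
  by move=> _ [s _ [C mC <-]]; rewrite setTI; exact: measurable_funPTI.
have mU : measurable_fun setT (idfun : Omega -> E).
  by move=> _ B mB; rewrite setTI; exact: subY.
have mY s : measurable_fun setT (Y s : E -> TY).
  move=> _ B mB; apply: sub_sigma_algebra; exists s => //.
  by exists B.
pose U : {mfun Omega >-> E} := HB.pack (idfun : Omega -> E)
  (isMeasurableFun.Build _ _ _ _ _ mU).
suff H m t : \int[P]_w quenched A m (fun k => Y (Posz (t + k)) w) (X t w) =
    P (X (t + m)%N @^-1` A).
  rewrite /distribution /pushforward -(H n 0%N).
  by apply: eq_integral => w _; rewrite X0.
elim: m t => [|m IHm] t.
  rewrite addn0 -[LHS]/(\int[P]_w (\1_(X t @^-1` A) w)%:E).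
  by rewrite integral_indic ?setIT//; exact: measurable_funPTI.
rewrite -addSnnS -IHm.
have mQ : measurable_fun setT (fun w => (Y (Posz t) w, X t w)).
  exact: measurable_fun_pair.
transitivity (\int[P]_w \int[kernel_pullback Q mQ w]_z
    quenched A m (fun k => Y (Posz (t.+1 + k)) w) z).
  apply: eq_integral => w _ /=; rewrite /kernel_pullback addn0.
  by apply: eq_integral => z _; apply: eq_quenched => k _ /=; rewrite addnS.
rewrite -(integral_disintegration (U := U) (X := X t.+1) (f := fun p =>
    quenched A m (fun k => Y (Posz (t.+1 + k)) p.1) p.2))//.
- move=> B C mB mC; have [_ ->//] := condX t C mC.
  apply: smallest_sub mB; first exact: smallest_sigma_algebra.
  by apply: subset_trans (@sub_gen_smallest _ _ _) => B' ?; right.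
- exact: (@measurable_quenched_env _ E A m
    (fun k => Y (Posz (t.+1 + k)) : E -> TY)).
- by move=> p; exact: quenched_ge0.
Qed.

Lemma stationary_integral (n : nat) (h : int) (f : (n.+1).-tuple TY -> \bar R) :
  strictly_stationary P Y -> measurable_fun setT f -> (forall e, 0 <= f e) ->
  \int[P]_w f [tuple Y (Posz i + h)%R w | i < n.+1] =
  \int[P]_w f [tuple Y (Posz i) w | i < n.+1].
Proof.
move=> statY mf f0.
have mtup (t : 'I_n.+1 -> int) :
    measurable_fun setT (fun w => [tuple Y (t i) w | i < n.+1]).
  apply/measurable_fun_tnthP => i.
  by apply: (eq_measurable_fun (Y (t i))) => // w _; rewrite /= tnth_mktuple.
rewrite -[LHS](@ge0_integral_pushforward _ _ _ _ _ _
  (mtup (fun i => Posz i + h)%R) P setT f)//.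
rewrite -[RHS](@ge0_integral_pushforward _ _ _ _ _ _
  (mtup (fun i => Posz i)) P setT f)//.
by apply: eq_measure_integral => A mA _; exact: (statY n.+1 (fun i => Posz i)).
Qed.

End quenched_transition.

(** * Contraction of the quenched oscillation *)

Lemma ge0_integral_Dcst d (T : measurableType d) (R : realType)
    (mu : {measure set T -> \bar R}) (f : T -> R) (c : R) :
  mu setT = 1 -> measurable_fun setT f -> (forall z, 0 <= f z)%R -> (0 <= c)%R ->
  \int[mu]_z (f z + c)%:E = \int[mu]_z (f z)%:E + c%:E.
Proof.
move=> mu1 mf f0 c0; under eq_integral do rewrite EFinD.
rewrite ge0_integralD//.
- by rewrite integral_cst// mu1 mule1.
- by move=> z _; rewrite lee_fin.
- exact/measurable_EFinP.
Qed.

(* Only a common minorant [(1 - a) kappa] of [mu] and [nu] matters: with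
   [M = sup (h - g)^+], both [M + g - h] and [h + g + c - M] are nonnegative,
   their integrals against [mu] and [nu] dominate [1 - a] times their integrals
   against [kappa], and their sum is at least [c]. *)
Lemma integral_oscillation d (T : measurableType d) (R : realType)
    (mu nu kappa : {measure set T -> \bar R}) (h g : T -> R) (a c : R) :
  mu setT = 1 -> nu setT = 1 -> kappa setT = 1 -> (0 <= c)%R -> (0 <= a <= 1)%R ->
  (forall A, measurable A -> (1 - a)%:E * kappa A <= mu A) ->
  (forall A, measurable A -> (1 - a)%:E * kappa A <= nu A) ->
  measurable_fun setT h -> measurable_fun setT g ->
  (forall z, 0 <= h z <= 1)%R -> (forall z, 0 <= g z)%R ->
  (forall z z', h z - h z' <= c + g z + g z')%R ->
  \int[mu]_z (h z)%:E <=
  \int[nu]_z (h z)%:E + (a * c)%:E +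
  (\int[mu]_z (g z)%:E + \int[nu]_z (g z)%:E).
Proof.
move=> mu1 nu1 ka1 c0 /andP[a0 a1] kamu kanu mh mg h01 g0 hg.
have h0 z : (0 <= h z)%R by case/andP: (h01 z).
(* Truncation at 0 keeps [M] nonnegative, so that it may be integrated as a nonnegative constant;
   [M <= h + g + c] survives since its right-hand side is nonnegative. *)
pose M := sup (range (fun z => Num.max 0%R (h z - g z)%R)).
have [z0 _] : [set: T] !=set0.
  apply/set0P/eqP => T0; move: mu1; rewrite T0 measure0 => /eqP.
  by rewrite lt_eqF// lte01.
have hsup : has_sup (range (fun z => Num.max 0%R (h z - g z)%R)).
  split; first by exists (Num.max 0%R (h z0 - g z0)%R), z0.
  exists 1%R => _ [z _ <-]; rewrite ge_max ler01/= lerBlDr.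
  by have /andP[_ h1] := h01 z; rewrite (le_trans h1)// lerDl.
have leM z : (h z - g z <= M)%R.
  apply: (@le_trans _ _ (Num.max 0 (h z - g z))%R); first by rewrite le_max lexx orbT.
  by apply: sup_upper_bound => //; exists z.
have M0 : (0 <= M)%R.
  apply: (@le_trans _ _ (Num.max 0 (h z0 - g z0))%R); first by rewrite le_max lexx.
  by apply: sup_upper_bound => //; exists z0.
have geM z : (M <= h z + g z + c)%R.
  apply: ge_sup => [|_ [z' _ <-]]; first by case: hsup.
  rewrite ge_max !addr_ge0//= lerBlDr.
  by have := hg z' z; lra.
pose phi z := (M + g z - h z)%R; pose psi z := (h z + g z + c - M)%R.
have phi0 z : (0 <= phi z)%R by rewrite /phi; have := leM z; lra.
have psi0 z : (0 <= psi z)%R by rewrite /psi; have := geM z; lra.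
have mphi : measurable_fun setT phi.
  by apply: measurable_funB => //; exact: measurable_funD.
have mpsi : measurable_fun setT psi.
  apply: measurable_funB => //; apply: measurable_funD => //.
  exact: measurable_funD.
have E1 : \int[mu]_z (phi z)%:E + \int[mu]_z (h z)%:E =
    \int[mu]_z (g z)%:E + M%:E.
  rewrite -ge0_integral_Dcst// -ge0_integralD//.
  - by apply: eq_integral => z _; rewrite -EFinD /phi; congr EFin; ring.
  - by move=> z _; rewrite lee_fin.
  - exact/measurable_EFinP.
  - by move=> z _; rewrite lee_fin.
  - exact/measurable_EFinP.
have E2 : \int[nu]_z (psi z)%:E + M%:E =
    \int[nu]_z (h z)%:E + \int[nu]_z (g z)%:E + c%:E.
  rewrite -ge0_integral_Dcst// -[in RHS]ge0_integralD//; last 4 first.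
  - by move=> z _; rewrite lee_fin.
  - exact/measurable_EFinP.
  - by move=> z _; rewrite lee_fin.
  - exact/measurable_EFinP.
  under [in RHS]eq_integral do rewrite -EFinD.
  rewrite -ge0_integral_Dcst//.
  - by apply: eq_integral => z _; rewrite /psi; congr EFin; ring.
  - exact: measurable_funD.
  - by move=> z; rewrite addr_ge0.
have minor (m : {measure set T -> \bar R}) (f : T -> R) :
    (forall A, measurable A -> (1 - a)%:E * kappa A <= m A) ->
    measurable_fun setT f -> (forall z, 0 <= f z)%R ->
    (1 - a)%:E * \int[kappa]_z (f z)%:E <= \int[m]_z (f z)%:E.
  move=> kam mf f0.
  have a10 : (0 <= 1 - a)%R by rewrite subr_ge0.
  have := @ge0_integral_mscale _ _ R kappa _ measurableT (NngNum a10) (EFin \o f).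
  move=> /= <-.
  - apply: ge0_le_measure_integral => //; first exact/measurable_EFinP.
  - exact/measurable_EFinP.
  - by move=> z _; rewrite lee_fin.
have E3 : ((1 - a) * c)%:E <= \int[mu]_z (phi z)%:E + \int[nu]_z (psi z)%:E.
  apply: le_trans (leeD (minor mu phi kamu mphi phi0) (minor nu psi kanu mpsi psi0)).
  rewrite -ge0_muleDr//; try by apply: integral_ge0 => z _; rewrite lee_fin.
  rewrite EFinM lee_wpmul2l// ?lee_fin ?subr_ge0//.
  rewrite -ge0_integralD//.
  - rewrite -[leLHS]mule1 -ka1 -integral_cst//; apply: ge0_le_integral => //.
    + by apply/measurable_EFinP; exact: measurable_funD.
    + by move=> z _; rewrite /= -EFinD lee_fin /phi /psi; have := g0 z; lra.
  - by move=> z _; rewrite lee_fin.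
  - exact/measurable_EFinP.
  - by move=> z _; rewrite lee_fin.
  - exact/measurable_EFinP.
have fin01 (m : {measure set T -> \bar R}) : m setT = 1 ->
    \int[m]_z (h z)%:E \is a fin_num.
  move=> m1; rewrite ge0_fin_numE; last by apply: integral_ge0 => z _; rewrite lee_fin.
  apply: (@le_lt_trans _ _ 1); last exact: ltry.
  rewrite -m1 -[leRHS]mul1e -integral_cst//; apply: ge0_le_integral => //.
  - by move=> z _; rewrite lee_fin.
  - exact/measurable_EFinP.
  - by move=> z _; rewrite lee_fin; case/andP: (h01 z).
have ge0i (m : {measure set T -> \bar R}) (f : T -> R) : (forall z, 0 <= f z)%R ->
    0 <= \int[m]_z (f z)%:E.
  by move=> f0; apply: integral_ge0 => z _; rewrite lee_fin.
move: E1 E2 E3 (fin01 _ mu1) (fin01 _ nu1) (ge0i mu _ phi0) (ge0i nu _ psi0)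
  (ge0i mu _ g0) (ge0i nu _ g0).
move: (\int[mu]_z (phi z)%:E) (\int[nu]_z (psi z)%:E) (\int[mu]_z (h z)%:E)
  (\int[nu]_z (h z)%:E) (\int[mu]_z (g z)%:E) (\int[nu]_z (g z)%:E).
(* If an integral of [g] is infinite, so is the right-hand side. Otherwise all six integrals are
   real and the claim is E1 + E2 combined with E3. *)
move=> [i1||] [i2||] [i3||] [i4||] [i5||] [i6||]//=; rewrite ?leey// ?addey// ?addye//.
move=> -[E1] -[E2]; rewrite -?EFinD !lee_fin => E3 _ _ _ _ _ _; lra.
Qed.

Section quenched_contraction.
Local Open Scope ring_scope.
Context dX dY (TX : measurableType dX) (TY : measurableType dY) (R : realType).
Variables (Q : R.-pker (TY * TX) ~> TX) (V : TX -> R) (gamma K : TY -> R).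
Hypothesis drift : drift_condition Q V gamma K.

Let mV : measurable_fun setT V. Proof. by case: drift => -[]. Qed.
Let V0 x : 0 <= V x. Proof. by case: drift => -[]. Qed.
Let gamma0 y : 0 < gamma y. Proof. by case: drift => _ []. Qed.
Let K1 y : 1 <= K y. Proof. by case: drift => _ _ []. Qed.
Let K0 y : 0 <= K y. Proof. exact: le_trans (K1 y). Qed.

(** Only [c] is ever contracted by the minorization; [A] and [B] are carried along by the drift.
    Uniformity in [D] is what becomes total variation. *)
Definition oscillation_bound (y : nat -> TY) (n : nat) (c A B : R) :=
  forall D, measurable D -> forall x x',
  fine (quenched Q D n y x) - fine (quenched Q D n y x') <=
  c + A * (V x + V x') + B.

Lemma fine_quenched01 D n y x : measurable D ->
  0 <= fine (quenched Q D n y x) <= 1.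
Proof.
move=> mD; rewrite fine_ge0 ?quenched_ge0//=.
by rewrite -lee_fin fineK ?quenched_le1// quenched_fin_num.
Qed.

Lemma quenched_diff_le1 D n y x x' : measurable D ->
  fine (quenched Q D n y x) - fine (quenched Q D n y x') <= 1.
Proof.
move=> mD; have /andP[h0 _] := fine_quenched01 n y x' mD.
by have /andP[_ h1] := fine_quenched01 n y x mD; lra.
Qed.

(** This is [integral_oscillation] with g = A V and the constant c + B. The gain on [B] is
    discarded: a B is weakened to B. *)
Lemma integral_oscillation_bound (mu nu kappa : {measure set TX -> \bar R}) y n
    (a c A B : R) D :
  mu setT = 1%E -> nu setT = 1%E -> kappa setT = 1%E -> 0 <= a <= 1 ->
  (forall D', measurable D' -> (1 - a)%:E * kappa D' <= mu D')%E ->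
  (forall D', measurable D' -> (1 - a)%:E * kappa D' <= nu D')%E ->
  0 <= c -> 0 <= A -> 0 <= B -> measurable D ->
  oscillation_bound y n c A B ->
  (\int[mu]_z quenched Q D n y z <= \int[nu]_z quenched Q D n y z +
   (a * c + B)%:E +
   A%:E * (\int[mu]_z (V z)%:E + \int[nu]_z (V z)%:E))%E.
Proof.
move=> mu1 nu1 ka1 a01 kamu kanu c0 A0 B0 mD osc.
have mq : measurable_fun setT (fun z => fine (quenched Q D n y z)).
  by apply: measurableT_comp => //; exact: measurable_quenched.
have mg : measurable_fun setT (fun z => A * V z) by exact: measurable_funM.
have := integral_oscillation mu1 nu1 ka1 (addr_ge0 c0 B0) a01 kamu kanu mq mg
  (fun z => fine_quenched01 n y z mD) (fun z => mulr_ge0 A0 (V0 z)).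
have fineE (m : {measure set TX -> \bar R}) :
    (\int[m]_z (fine (quenched Q D n y z))%:E = \int[m]_z quenched Q D n y z)%E.
  by apply: eq_integral => z _; rewrite fineK// quenched_fin_num.
have VE (m : {measure set TX -> \bar R}) :
    (\int[m]_z (A * V z)%:E = A%:E * \int[m]_z (V z)%:E)%E.
  rewrite -ge0_integralZl//; first exact/measurable_EFinP.
  by move=> z _; rewrite lee_fin.
rewrite !fineE !VE => /(_ _)/le_trans; apply.
  by move=> z z'; have := osc D mD z z'; lra.
rewrite -ge0_muleDr//; try by apply: integral_ge0 => z _; rewrite lee_fin.
rewrite leeD2r// leeD2l// lee_fin mulrDr lerD2l ler_piMl//.
by case/andP: a01.
Qed.

Lemma quenched_step (kappa : {measure set TX -> \bar R}) y n (a c A B : R) D x x' :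
  kappa setT = 1%E -> 0 <= a <= 1 ->
  (forall D', measurable D' -> (1 - a)%:E * kappa D' <= Q (y 0%N, x) D')%E ->
  (forall D', measurable D' -> (1 - a)%:E * kappa D' <= Q (y 0%N, x') D')%E ->
  0 <= c -> 0 <= A -> 0 <= B -> measurable D ->
  oscillation_bound (y \o S) n c A B ->
  fine (quenched Q D n.+1 y x) - fine (quenched Q D n.+1 y x') <=
  a * c + gamma (y 0%N) * A * (V x + V x') + (B + 2 * K (y 0%N) * A).
Proof.
move=> ka1 a01 kax kax' c0 A0 B0 mD osc.
have := integral_oscillation_bound (prob_kernel (s := Q) _)
  (prob_kernel (s := Q) _) ka1 a01 kax kax' c0 A0 B0 mD osc.
have qE x1 : (\int[Q (y 0%N, x1)]_z quenched Q D n (y \o S) z =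
    (fine (quenched Q D n.+1 y x1))%:E)%E.
  by rewrite fineK// quenched_fin_num.
rewrite !qE => le1.
case: drift => _ _ _ QV.
have le2 : (A%:E * (\int[Q (y 0%N, x)]_z (V z)%:E +
    \int[Q (y 0%N, x')]_z (V z)%:E) <=
    (A * ((gamma (y 0%N) * V x + K (y 0%N)) +
          (gamma (y 0%N) * V x' + K (y 0%N))))%:E)%E.
  by rewrite EFinM lee_wpmul2l ?lee_fin// EFinD leeD.
have := le_trans le1 (leeD2l _ le2).
by rewrite -!EFinD lee_fin; lra.
Qed.

Definition growth (y : nat -> TY) (l : nat) : R := \prod_(k < l) gamma (y k).

(** Iterating the map v -> gamma v + K along the first [p] times gives slope [growth y p] and
    constant term [forcing y p 0]; the index [l] multiplies that constant by the growth over the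
    next [l] times. It is kept as one sum because each summand then has a drift moment as its
    mean. *)
Definition forcing (y : nat -> TY) (p l : nat) : R :=
  \sum_(i < p) K (y i) * \prod_(i.+1 <= k < p + l) gamma (y k).

Lemma growth_ge0 y l : 0 <= growth y l.
Proof. by apply: prodr_ge0 => k _; exact: ltW. Qed.

Lemma forcing_ge0 y p l : 0 <= forcing y p l.
Proof.
apply: sumr_ge0 => k _; rewrite mulr_ge0//.
by apply: prodr_ge0 => i _; exact: ltW.
Qed.

Lemma growthS y l : growth y l.+1 = gamma (y 0%N) * growth (y \o S) l.
Proof. by rewrite /growth big_ord_recl. Qed.

Lemma growthD y l p :
  growth y (l + p) = growth y l * growth (fun k => y (l + k)%N) p.
Proof. by rewrite /growth big_split_ord. Qed.

Lemma forcingS y p l : forcing y p.+1 l =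
  K (y 0%N) * growth (y \o S) (p + l) + forcing (y \o S) p l.
Proof.
rewrite /forcing big_ord_recl; congr (_ * _ + _).
  by rewrite big_add1 addSn /= big_mkord.
by apply: eq_bigr => i _; rewrite addSn big_add1.
Qed.

Lemma forcingD y l p q : forcing y (l + p) q =
  forcing y l 0 * growth (fun k => y (l + k)%N) (p + q) +
  forcing (fun k => y (l + k)%N) p q.
Proof.
elim: l y => [|l IHl] y.
  by rewrite /forcing big_ord0 mul0r add0r.
rewrite addSn !forcingS (IHl (y \o S)) addn0 mulrDl addrA; congr (_ + _ + _).
by rewrite -addnA growthD mulrA.
Qed.

Lemma oscillation_drift y n c A B : 0 <= c -> 0 <= A -> 0 <= B ->
  oscillation_bound (y \o S) n c A B ->
  oscillation_bound y n.+1 c (gamma (y 0%N) * A) (B + 2 * K (y 0%N) * A).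
Proof.
move=> c0 A0 B0 osc D mD x x'.
(* With a = 1 the common minorant vanishes, so that [quenched_step] uses the drift alone and leaves
   [c] unchanged. *)
have triv x1 D' : measurable D' -> ((1 - 1)%:E * Q (y 0%N, x) D' <= Q (y 0%N, x1) D')%E.
  by rewrite subrr mul0e.
have := @quenched_step (Q (y 0%N, x)) y n 1 c A B D x x' (prob_kernel _)
  _ (triv x) (triv x') c0 A0 B0 mD osc.
by rewrite mul1r; apply; rewrite ler01 lexx.
Qed.

Lemma oscillation_drift_iter l y n c A B : 0 <= c -> 0 <= A -> 0 <= B ->
  oscillation_bound (fun k => y (l + k)%N) n c A B ->
  oscillation_bound y (l + n) c (growth y l * A) (B + 2 * forcing y l 0 * A).
Proof.
move=> c0 A0 B0; elim: l y => [|l IHl] y osc.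
  by rewrite /growth /forcing !big_ord0 mul1r mulr0 mul0r addr0.
have A'0 : 0 <= growth (y \o S) l * A by rewrite mulr_ge0// growth_ge0.
have B'0 : 0 <= B + 2 * forcing (y \o S) l 0 * A.
  by rewrite addr_ge0// !mulr_ge0// forcing_ge0.
have H := oscillation_drift c0 A'0 B'0 (IHl (y \o S) osc).
rewrite growthS forcingS addn0 => D mD x x'.
by have := H D mD x x'; rewrite addSn; lra.
Qed.

Variables (gbar eps : R) (alpha : TY -> R) (kappa : R.-pker TY ~> TX).
Hypothesis minor : minorization_condition Q V gamma K gbar eps alpha kappa.

Let eps0 : 0 < eps. Proof. by case: minor => -[_ /andP[]]. Qed.
Let alpha01 y : 0 <= alpha y <= 1.
Proof. by case: minor => _ [_ /(_ y)/andP[-> /ltW]]. Qed.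

Lemma quenched_step_level y n (c A B : R) D x x' :
  0 <= c -> 0 <= A -> 0 <= B -> measurable D ->
  V x <= 2 * K (y 0%N) / (eps * gamma (y 0%N)) ->
  V x' <= 2 * K (y 0%N) / (eps * gamma (y 0%N)) ->
  oscillation_bound (y \o S) n c A B ->
  fine (quenched Q D n.+1 y x) - fine (quenched Q D n.+1 y x') <=
  alpha (y 0%N) * c + gamma (y 0%N) * A * (V x + V x') + (B + 2 * K (y 0%N) * A).
Proof.
move=> c0 A0 B0 mD Vx Vx'; apply: (quenched_step (prob_kernel (s := kappa) (y 0%N))) => //.
all: move=> D' mD'; case: minor => _ _ /(_ (y 0%N) D' mD')/le_trans + _; apply.
all: apply: ereal_inf_lbound.
  by exists x => //=; rewrite in_itv/= V0.
by exists x' => //=; rewrite in_itv/= V0.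
Qed.

(** A drift step costs 2 K, one K for each copy. The threshold of the level set is chosen so that a
    single copy above it already makes the sum pay for both, V being nonnegative. *)
Lemma outside_level y x x' :
  ~ (V x <= 2 * K y / (eps * gamma y) /\ V x' <= 2 * K y / (eps * gamma y)) ->
  2 * K y <= eps * gamma y * (V x + V x').
Proof.
move=> out; have eg : 0 < eps * gamma y by rewrite mulr_gt0.
rewrite -ler_pdivrMl// mulrC.
have [Vx|Vx] := leP (V x) (2 * K y / (eps * gamma y)); last first.
  by rewrite (le_trans (ltW Vx))// lerDl.
have [Vx'|Vx'] := leP (V x') (2 * K y / (eps * gamma y)); first by exfalso; apply: out.
by rewrite (le_trans (ltW Vx'))// lerDr.
Qed.

(* Inside the level set the minorization gains the factor [a], once per block.
   Outside it, [2 K <= eps gamma (V x + V x')], so the drift constant is absorbed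
   by the factor [1 + eps]; a pair that never enters the level set during the
   block still satisfies [V x + V x' >= 2 / (eps gamma)] at its last step, which
   is where [eps / 2] comes from. *)
Lemma oscillation_block l y n a c A B : 0 <= c -> 0 <= A -> 0 <= B ->
  (forall k, (k <= l)%N -> alpha (y k) <= a) ->
  oscillation_bound (fun k => y (l.+1 + k)%N) n c A B ->
  oscillation_bound y (l.+1 + n) (a * c)
    (growth y l.+1 * A + eps / 2 * (1 + eps) ^+ l * growth y l.+1)
    (B + 2 * forcing y l.+1 0 * A).
Proof.
move=> c0 A0 B0 ya osc; set e := fun j => eps / 2 * (1 + eps) ^+ j.
have e0 j : 0 <= e j by rewrite mulr_ge0 ?exprn_ge0// ?addr_ge0// ?divr_ge0// ltW.
(* The pair is in the level set at the first time of [y']: the factor [a] is gained there, and the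
   remaining [j] steps of the block use the drift only. *)
have within j (y' : nat -> TY) D x x' : measurable D -> alpha (y' 0%N) <= a ->
    oscillation_bound (fun k => y' (j.+1 + k)%N) n c A B ->
    V x <= 2 * K (y' 0%N) / (eps * gamma (y' 0%N)) ->
    V x' <= 2 * K (y' 0%N) / (eps * gamma (y' 0%N)) ->
    fine (quenched Q D (j.+1 + n) y' x) - fine (quenched Q D (j.+1 + n) y' x') <=
    a * c + (growth y' j.+1 * A + e j * growth y' j.+1) * (V x + V x') +
    (B + 2 * forcing y' j.+1 0 * A).
  move=> mD y'a osc' Vx Vx'.
  have A'0 : 0 <= growth (y' \o S) j * A by rewrite mulr_ge0// growth_ge0.
  have B'0 : 0 <= B + 2 * forcing (y' \o S) j 0 * A.
    by rewrite addr_ge0// !mulr_ge0// forcing_ge0.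
  have := quenched_step_level c0 A'0 B'0 mD Vx Vx'
    (oscillation_drift_iter (y := y' \o S) c0 A0 B0 osc').
  have ac : alpha (y' 0%N) * c <= a * c by rewrite ler_wpM2r.
  have eW : 0 <= e j * growth y' j.+1 * (V x + V x').
    by rewrite mulr_ge0 ?addr_ge0// mulr_ge0// growth_ge0.
  by rewrite addSn growthS forcingS addn0 in eW *; lra.
elim: l y ya osc => [|l IHl] y ya osc D mD x x'.
  have [[Vx Vx']|/outside_level out] := pselect (V x <= 2 * K (y 0%N) / (eps * gamma (y 0%N)) /\
    V x' <= 2 * K (y 0%N) / (eps * gamma (y 0%N))).
    by apply: within => //; exact: ya.
  have a0 : 0 <= a by case/andP: (alpha01 (y 0%N)) => /le_trans + _; apply; exact: ya.
  have := quenched_diff_le1 (1 + n) y x x' mD.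
  have := mulr_ge0 a0 c0.
  have := mulr_ge0 (mulr_ge0 (growth_ge0 y 1) A0) (addr_ge0 (V0 x) (V0 x')).
  have := mulr_ge0 (forcing_ge0 y 1 0) A0.
  have := K1 (y 0%N).
  rewrite /e expr0 mulr1.
  have -> : growth y 1 = gamma (y 0%N) by rewrite /growth big_ord1.
  lra.
have [[Vx Vx']|/outside_level out] := pselect (V x <= 2 * K (y 0%N) / (eps * gamma (y 0%N)) /\
    V x' <= 2 * K (y 0%N) / (eps * gamma (y 0%N))).
  by apply: within => //; exact: ya.
have osc' : oscillation_bound (fun k => (y \o S) (l.+1 + k)%N) n c A B by exact: osc.
have IH := IHl (y \o S) (fun k kl => ya k.+1 kl) osc'.
have ac0 : 0 <= a * c.
  by rewrite mulr_ge0//; case/andP: (alpha01 (y 0%N)) => /le_trans + _; apply; exact: ya.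
have A'0 : 0 <= growth (y \o S) l.+1 * A + e l * growth (y \o S) l.+1.
  by rewrite addr_ge0// mulr_ge0// growth_ge0.
have B'0 : 0 <= B + 2 * forcing (y \o S) l.+1 0 * A.
  by rewrite addr_ge0// !mulr_ge0// forcing_ge0.
have := oscillation_drift ac0 A'0 B'0 IH mD x x'.
(* Of the new constant term, the part proportional to [A] goes into [forcing]; only the part
   proportional to [e l] is absorbed by the slope, which turns [e l] into (1 + eps) [e l]. *)
have : 2 * K (y 0%N) * (e l * growth (y \o S) l.+1) <=
    eps * gamma (y 0%N) * (V x + V x') * (e l * growth (y \o S) l.+1).
  by rewrite ler_wpM2r// mulr_ge0// growth_ge0.
have -> : eps / 2 * (1 + eps) ^+ l.+1 = (1 + eps) * e l by rewrite /e exprS; ring.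
rewrite [(l.+2 + n)%N]addSn (growthS y) (forcingS y) addn0.
lra.
Qed.

(** Block [i] adds [e] times its own growth as a slope in V. Pulled back by the drift through the
    [i] blocks before it, this slope becomes [growth y (i.+1 * l.+1)] and leaves the constant
    [2 * forcing y (i * l.+1) l.+1], up to the factor [e]. The recursion starts from the trivial
    bound 1 on the oscillation of the last [n] steps. *)
Lemma oscillation_blocks m l y n a :
  (forall k, (k < m * l.+1)%N -> alpha (y k) <= a) -> 0 <= a ->
  let e := eps / 2 * (1 + eps) ^+ l in
  oscillation_bound y (m * l.+1 + n) (a ^+ m)
    (e * \sum_(i < m) growth y (i.+1 * l.+1))
    (2 * e * \sum_(i < m) forcing y (i * l.+1) l.+1).
Proof.
move=> + a0 e; have e0 : 0 <= e.
  by rewrite mulr_ge0 ?exprn_ge0// ?addr_ge0// ?divr_ge0// ltW.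
elim: m y => [|m IHm] y ya.
  move=> D mD x x'; rewrite !big_ord0 !mulr0 mul0r !addr0 expr0.
  exact: quenched_diff_le1.
have ya' k : (k < m * l.+1)%N -> alpha (y (l.+1 + k)%N) <= a.
  by move=> km; apply: ya; rewrite mulSn ltn_add2l.
have A0 : 0 <= e * \sum_(i < m) growth (fun k => y (l.+1 + k)%N) (i.+1 * l.+1).
  by rewrite mulr_ge0// sumr_ge0// => i _; exact: growth_ge0.
have B0 : 0 <= 2 * e * \sum_(i < m) forcing (fun k => y (l.+1 + k)%N) (i * l.+1) l.+1.
  by apply: mulr_ge0; [exact: mulr_ge0 | apply: sumr_ge0 => i _; exact: forcing_ge0].
have := @oscillation_block l y _ a _ _ _ (exprn_ge0 m a0) A0 B0 _ (IHm _ ya').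
rewrite addnA -mulSn => H.
have {}H D mD x x' := H (fun k kl => ya k (leq_trans (kl : (k < l.+1)%N) (leq_addr _ _))) D mD x x'.
move=> D mD x x'; move: (H D mD x x').
rewrite -/e exprS.
have -> : \sum_(i < m.+1) growth y (i.+1 * l.+1) = growth y l.+1 +
    growth y l.+1 * \sum_(i < m) growth (fun k => y (l.+1 + k)%N) (i.+1 * l.+1).
  rewrite big_ord_recl mul1n mulr_sumr; congr (_ + _).
  by apply: eq_bigr => i _; rewrite -growthD -mulSn.
have -> : \sum_(i < m.+1) forcing y (i * l.+1) l.+1 =
    forcing y l.+1 0 * (\sum_(i < m) growth (fun k => y (l.+1 + k)%N) (i.+1 * l.+1)) +
    \sum_(i < m) forcing (fun k => y (l.+1 + k)%N) (i * l.+1) l.+1.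
  rewrite big_ord_recl mul0n {1}/forcing big_ord0 add0r mulr_sumr -big_split.
  by apply: eq_bigr => i _ /=; rewrite [in LHS]mulSn forcingD addnC -mulSn.
lra.
Qed.

End quenched_contraction.

(** * Averaging over the environment *)

Lemma measurable_fun_bigmaxr d (T : measurableType d) (R : realType) (I : Type)
    (s : seq I) (f : I -> T -> R) (x0 : R) :
  (forall i, measurable_fun setT (f i)) ->
  measurable_fun setT (fun x => \big[Num.max/x0]_(i <- s) f i x)%R.
Proof.
move=> mf; elim: s => [|i s IHs].
  by under eq_fun do rewrite big_nil; exact: measurable_cst.
by under eq_fun do rewrite big_cons; exact: measurable_maxr.
Qed.

Section annealed_growth.
Context d (Omega : measurableType d) (R : realType) (P : probability Omega R)
  dY (TY : measurableType dY) (Y : int -> {mfun Omega >-> TY}) (gamma K : TY -> R).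
Hypotheses (statY : strictly_stationary P Y)
  (mgamma : measurable_fun setT gamma) (gamma0 : forall y, (0 < gamma y)%R)
  (mK : measurable_fun setT K) (K1 : forall y, (1 <= K y)%R).

Let K0 y : (0 <= K y)%R. Proof. exact: le_trans (K1 y). Qed.

Let prod_ge0 (s : seq nat) (f : nat -> TY) : (0 <= \prod_(k <- s) gamma (f k))%R.
Proof. by apply: prodr_ge0 => k _; exact: ltW. Qed.

Definition drift_moment (q : nat) : \bar R :=
  'E_P[fun w => (K (Y 0 w) * \prod_(1 <= k < q.+1) gamma (Y (Posz k) w))%R].

Lemma drift_moment_shift (h : int) q :
  \int[P]_w (K (Y h w) *
    \prod_(1 <= k < q.+1) gamma (Y (Posz k + h)%R w))%:E = drift_moment q.
Proof.
pose f (e : q.+1.-tuple TY) : \bar R := (K (tnth e ord0) *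
  \prod_(1 <= k < q.+1) gamma (tnth e (inord k)))%:E.
have fE h' w : f [tuple Y (Posz i + h')%R w | i < q.+1] = (K (Y h' w) *
    \prod_(1 <= k < q.+1) gamma (Y (Posz k + h')%R w))%:E.
  rewrite /f tnth_mktuple add0r; congr (_ * _)%:E.
  rewrite !big_seq; apply: eq_bigr => k; rewrite mem_index_iota => /andP[_ kq].
  by rewrite tnth_mktuple inordK.
have := @stationary_integral _ _ _ _ _ P Y q h f statY.
under eq_integral do rewrite fE.
have -> : \int[P]_w f [tuple Y (Posz i) w | i < q.+1] = drift_moment q.
  rewrite /drift_moment unlock; apply: eq_integral => w _.
  transitivity (f [tuple Y (Posz i + 0)%R w | i < q.+1]).
    by congr f; apply: eq_from_tnth => i; rewrite !tnth_mktuple addr0.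
  rewrite fE; congr (_ * _)%:E.
  by apply: eq_bigr => k _; rewrite addr0.
apply.
- apply/measurable_EFinP; apply: measurable_funM.
    by apply: measurableT_comp => //; exact: measurable_tnth.
  apply: measurable_prod => k _.
  by apply: measurableT_comp => //; exact: measurable_tnth.
- by move=> e; rewrite lee_fin mulr_ge0.
Qed.

Let y w k := Y (Posz k) w.

Lemma integral_growth p :
  \int[P]_w (K (Y (-1) w) * growth gamma (y w) p)%:E = drift_moment p.
Proof.
rewrite -(drift_moment_shift (-1)); apply: eq_integral => w _.
congr (_ * _)%:E; rewrite big_add1 /= big_mkord; apply: eq_bigr => k _.
by congr (gamma (Y _ w)); rewrite intS; ring.
Qed.

(* The missing factor [K] is supplied by [K >= 1] one step earlier. *)
Lemma integral_gamma_growth p :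
  \int[P]_w (gamma (Y (-1) w) * growth gamma (y w) p)%:E <= drift_moment p.+1.
Proof.
rewrite -(drift_moment_shift (-2)).
have mg q : measurable_fun setT (fun w => growth gamma (y w) q).
  by apply: measurable_prod => k _; exact: measurableT_comp.
have g0 w q : (0 <= growth gamma (y w) q)%R.
  by apply: prodr_ge0 => k _; exact: ltW.
apply: ge0_le_integral => //.
- by move=> w _; rewrite lee_fin mulr_ge0// ltW.
- apply/measurable_EFinP; apply: measurable_funM => //.
  exact: measurableT_comp.
- apply/measurable_EFinP; apply: measurable_funM => //.
    exact: measurableT_comp.
  by apply: measurable_prod => k _; exact: measurableT_comp.
- move=> w _; rewrite lee_fin big_add1 /= big_mkord big_ord_recl /=.
  rewrite [leRHS](_ : _ = K (Y (-2) w) * (gamma (Y (-1) w) * growth gamma (y w) p))%R.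
    by rewrite ler_peMl// mulr_ge0// ltW.
  congr (_ * (_ * _))%R; apply: eq_bigr => i _; congr (gamma (Y _ w)).
  by rewrite /bump leq0n add1n !intS; ring.
Qed.

Lemma integral_forcing p l :
  \int[P]_w (forcing gamma K (y w) p l)%:E =
  \sum_(i < p) drift_moment (p + l - i.+1).
Proof.
under eq_integral do rewrite /forcing -sumEFin.
rewrite ge0_integral_sum//.
- apply: eq_bigr => i _; rewrite -(drift_moment_shift (Posz i)).
  apply: eq_integral => w _; congr (_ * _)%:E.
  have -> : (p + l = (p + l - i.+1).+1 + i)%N.
    by rewrite addSnnS subnK// ltn_addr.
  rewrite -{1}[i.+1]add1n big_addn addnK /= addSn subSS addnK.
  by apply: eq_bigr => k _; rewrite /y PoszD.
- move=> i; apply/measurable_EFinP; apply: measurable_funM.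
    exact: measurableT_comp.
  by apply: measurable_prod => k _; exact: measurableT_comp.
- by move=> i w _; rewrite lee_fin mulr_ge0.
Qed.

Variables (r : R) (n0 : nat).
Hypotheses (r01 : (0 <= r <= 1)%R)
  (moment_le : forall q, (n0 <= q)%N -> drift_moment q <= (r ^+ q)%:E).

Let r0 : (0 <= r)%R. Proof. by case/andP: r01. Qed.

Let moment_le' q l : (n0 <= l)%N -> (l <= q)%N -> drift_moment q <= (r ^+ l)%:E.
Proof.
move=> nl lq; apply: le_trans (moment_le (leq_trans nl lq)) _.
by rewrite lee_fin ler_wiXn2l//; case/andP: r01.
Qed.

(** Every drift moment that occurs has length at least [l], so each is at most r^l because r <= 1.
    There are two of them per slope and at most m l per forcing term. *)
Lemma annealed_bound m l (e c : R) : (n0 <= l)%N -> (0 <= e)%R -> (0 <= c)%R ->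
  \int[P]_w (e * (\sum_(i < m) growth gamma (y w) (i.+1 * l)) *
               (c * (gamma (Y (-1) w) + K (Y (-1) w))) +
             2 * e * \sum_(i < m) forcing gamma K (y w) (i * l) l)%:E <=
  (2 * e * (c + m%:R * l%:R) * m%:R * r ^+ l)%:E.
Proof.
move=> nl e0 c0.
have g0 w q : (0 <= growth gamma (y w) q)%R.
  by apply: prodr_ge0 => k _; exact: ltW.
have mg q : measurable_fun setT (fun w => growth gamma (y w) q).
  by apply: measurable_prod => k _; exact: measurableT_comp.
have f0 w p q : (0 <= forcing gamma K (y w) p q)%R.
  by apply: sumr_ge0 => k _; rewrite mulr_ge0.
have mf p q : measurable_fun setT (fun w => forcing gamma K (y w) p q).
  apply: measurable_sum => i; apply: measurable_funM.
    exact: measurableT_comp.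
  by apply: measurable_prod => k _; exact: measurableT_comp.
have mgY h : measurable_fun setT (gamma \o Y h) by exact: measurableT_comp.
have mKY h : measurable_fun setT (K \o Y h) by exact: measurableT_comp.
pose F (i : 'I_m) w : \bar R :=
  (e * c)%:E * ((gamma (Y (-1) w) * growth gamma (y w) (i.+1 * l))%:E +
  (K (Y (-1) w) * growth gamma (y w) (i.+1 * l))%:E) +
  (2 * e)%:E * (forcing gamma K (y w) (i * l) l)%:E.
have eF w : (e * (\sum_(i < m) growth gamma (y w) (i.+1 * l)) *
    (c * (gamma (Y (-1) w) + K (Y (-1) w))) +
    2 * e * \sum_(i < m) forcing gamma K (y w) (i * l) l)%:E = \sum_(i < m) F i w.
  rewrite !mulr_sumr mulr_suml -big_split /= -sumEFin.
  apply: eq_bigr => i _; rewrite -[RHS]/((e * c *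
    (gamma (Y (-1) w) * growth gamma (y w) (i.+1 * l) +
     K (Y (-1) w) * growth gamma (y w) (i.+1 * l)) +
    2 * e * forcing gamma K (y w) (i * l) l)%:E).
  by congr EFin; ring.
under eq_integral do rewrite eF.
have ec0 : (0 <= e * c)%R by rewrite mulr_ge0.
have e20 : (0 <= 2 * e)%R by rewrite mulr_ge0.
have mg1 q : measurable_fun setT (fun w => (gamma (Y (-1) w) * growth gamma (y w) q)%:E).
  by apply/measurable_EFinP; exact: (measurable_funM (mgY _) (mg q)).
have mg2 q : measurable_fun setT (fun w => (K (Y (-1) w) * growth gamma (y w) q)%:E).
  by apply/measurable_EFinP; exact: (measurable_funM (mKY _) (mg q)).
have mf' p q : measurable_fun setT (fun w => (forcing gamma K (y w) p q)%:E).
  exact/measurable_EFinP.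
have g10 w q : 0 <= (gamma (Y (-1) w) * growth gamma (y w) q)%:E.
  by rewrite lee_fin mulr_ge0// ltW.
have g20 w q : 0 <= (K (Y (-1) w) * growth gamma (y w) q)%:E.
  by rewrite lee_fin mulr_ge0.
have f0' w p q : 0 <= (forcing gamma K (y w) p q)%:E by rewrite lee_fin.
rewrite ge0_integral_sum//; last 2 first.
- move=> i; apply: emeasurable_funD; apply: measurable_funeM => //.
  exact: emeasurable_funD.
- by move=> i w _; rewrite adde_ge0// mule_ge0// adde_ge0.
apply: (@le_trans _ _ (\sum_(i < m) (2 * e * (c + m%:R * l%:R) * r ^+ l)%:E)); last first.
  rewrite sumEFin sumr_const card_ord lee_fin -mulr_natr; lra.
apply: lee_sum => i _; rewrite /F.
rewrite ge0_integralD//; last 4 first.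
- by move=> w _; rewrite mule_ge0// adde_ge0.
- by apply: measurable_funeM; exact: emeasurable_funD.
- by move=> w _; rewrite mule_ge0.
- exact: measurable_funeM.
rewrite !ge0_integralZl//; last 2 first.
- exact: emeasurable_funD.
- by move=> w _; rewrite adde_ge0.
rewrite ge0_integralD// integral_forcing integral_growth.
have lil : (l <= i.+1 * l)%N by rewrite leq_pmull.
have forc : \sum_(k < i * l) drift_moment (i * l + l - k.+1) <=
    (m%:R * l%:R * r ^+ l)%:E.
  apply: (@le_trans _ _ (\sum_(k < i * l) (r ^+ l)%:E)).
    apply: lee_sum => k _; apply: moment_le' => //.
    by rewrite -addnBAC ?leq_addl.
  rewrite sumEFin sumr_const card_ord lee_fin -[(_ *+ (i * l))%R]mulr_natl.
  by rewrite ler_wpM2r ?exprn_ge0// -natrM ler_nat leq_mul// ltnW.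
have gam := le_trans (integral_gamma_growth (i.+1 * l)) (moment_le' nl (leqW lil)).
have := leeD (lee_wpmul2l _ (leeD gam (moment_le' nl lil))) (lee_wpmul2l _ forc).
move=> /(_ (e * c)%:E (2 * e)%:E); rewrite !lee_fin => /(_ ec0 e20)/le_trans; apply.
rewrite -[leLHS]/((e * c * (r ^+ l + r ^+ l) +
  2 * e * (m%:R * l%:R * r ^+ l))%:E) lee_fin; lra.
Qed.

End annealed_growth.

(** The maximum is attained, so it commutes with powers; the exponent drops to m - 1, the one in the
    announced bound, because the values are at most 1. *)
Lemma exprn_bigmax_le (R : realDomainType) (f : nat -> R) (m N : nat) :
  (0 < m)%N -> (0 < N)%N -> (forall k, (0 <= f k <= 1)%R) ->
  ((\big[Num.max/0]_(0 <= k < N) f k) ^+ m <=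
   \big[Num.max/0]_(0 <= k < N) f k ^+ (m - 1))%R.
Proof.
move=> m0 N0 f01; rewrite !big_mkord.
have [i _ ->] := @eq_bigmax _ _ _ 0%R (Ordinal N0) xpredT (fun i : 'I_N => f i)
  isT (fun i _ => proj1 (andP (f01 i))).
apply: (@le_trans _ _ (f i ^+ (m - 1))%R).
  have /andP[fi0 fi1] := f01 i.
  by rewrite ler_wiXn2l// leq_subr.
exact: (le_bigmax_cond _ (fun i : 'I_N => f i ^+ (m - 1))%R).
Qed.

(** * Mean contraction for two starting laws that depend on the environment *)

Section annealed_contraction.
Context d (Omega : measurableType d) (R : realType) (P : probability Omega R)
  dX (TX : measurableType dX) dY (TY : measurableType dY)
  (Y : int -> {mfun Omega >-> TY}) (Q : R.-pker (TY * TX) ~> TX)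
  (V : TX -> R) (gamma K : TY -> R) (gbar eps : R) (alpha : TY -> R)
  (kappa : R.-pker TY ~> TX) (r : R) (n0 : nat).
Hypotheses (statY : strictly_stationary P Y) (drift : drift_condition Q V gamma K)
  (minor : minorization_condition Q V gamma K gbar eps alpha kappa)
  (r01 : (0 <= r <= 1)%R)
  (moment_le : forall q, (n0 <= q)%N -> drift_moment P Y gamma K q <= (r ^+ q)%:E).

Let y w k := Y (Posz k) w.

Definition coupling_failure (m : nat) : \bar R :=
  'E_P[fun w => (\big[Num.max/0]_(0 <= k < m ^ 3)
                   alpha (Y (Posz k) w) ^+ (m - 1))%R].

(** The value of [annealed_bound] for [m] blocks of length m^2. The predecessor appears because a
    block of l + 1 steps costs (1 + eps)^l. *)
Definition escape_bound (c : R) (m : nat) : R :=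
  (2 * (eps / 2 * (1 + eps) ^+ (m ^ 2).-1) * (c + m%:R * (m ^ 2)%:R) * m%:R *
    r ^+ (m ^ 2))%R.

Let eps0 : (0 < eps)%R. Proof. by case: minor => -[_ /andP[]]. Qed.
Let alpha01 z : (0 <= alpha z <= 1)%R.
Proof. by case: minor => _ [_ /(_ z)/andP[-> /ltW]]. Qed.
Let mV : measurable_fun setT V. Proof. by case: drift => -[]. Qed.
Let V0 x : (0 <= V x)%R. Proof. by case: drift => -[]. Qed.

Lemma annealed_contraction (mu nu : Omega -> {measure set TX -> \bar R})
    (c : R) n m D :
  (0 < m)%N -> (m ^ 3 <= n)%N -> (n0 <= m ^ 2)%N -> (0 <= c)%R -> measurable D ->
  (forall w, mu w setT = 1) -> (forall w, nu w setT = 1) ->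
  (forall w, \int[mu w]_x (V x)%:E + \int[nu w]_x (V x)%:E <=
    (c * (gamma (Y (-1) w) + K (Y (-1) w)))%:E) ->
  measurable_fun setT (fun w => \int[mu w]_x quenched Q D n (y w) x) ->
  measurable_fun setT (fun w => \int[nu w]_x quenched Q D n (y w) x) ->
  \int[P]_w \int[mu w]_x quenched Q D n (y w) x <=
  \int[P]_w \int[nu w]_x quenched Q D n (y w) x +
  (coupling_failure m + (escape_bound c m)%:E).
Proof.
move=> m0 mn nm c0 mD mu1 nu1 muV mmu mnu.
have [[mgamma gamma0] [mK K1]] : (measurable_fun setT gamma /\ (forall z, 0 < gamma z)%R) /\
    (measurable_fun setT K /\ (forall z, 1 <= K z)%R) by case: drift.
have K0 z : (0 <= K z)%R by exact: le_trans (K1 z).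
have malpha : measurable_fun setT alpha by case: minor => _ [].
set e := (eps / 2 * (1 + eps) ^+ (m ^ 2).-1)%R.
have e0 : (0 <= e)%R by rewrite mulr_ge0 ?exprn_ge0// ?addr_ge0// ?divr_ge0// ltW.
have m2 : (m ^ 2).-1.+1 = (m ^ 2)%N by rewrite prednK// expn_gt0 m0.
have m3 : (m * m ^ 2)%N = (m ^ 3)%N by rewrite expnS.
pose a w := \big[Num.max/0%R]_(0 <= k < m ^ 3) alpha (y w k).
pose b w := (\big[Num.max/0%R]_(0 <= k < m ^ 3) alpha (y w k) ^+ (m - 1))%R.
pose A w := (e * \sum_(i < m) growth gamma (y w) (i.+1 * m ^ 2))%R.
pose B w := (2 * e * \sum_(i < m) forcing gamma K (y w) (i * m ^ 2) (m ^ 2))%R.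
have a0 w : (0 <= a w)%R.
  apply: (big_ind (fun t : R => (0 <= t)%R)) => // [u v u0 v0|k _]; first by rewrite le_max u0.
  by case/andP: (alpha01 (y w k)).
have b0 w : (0 <= b w)%R.
  apply: (big_ind (fun t : R => (0 <= t)%R)) => // [u v u0 v0|k _]; first by rewrite le_max u0.
  by rewrite exprn_ge0//; case/andP: (alpha01 (y w k)).
have A0 w : (0 <= A w)%R.
  by rewrite mulr_ge0// sumr_ge0// => i _; exact: (growth_ge0 drift).
have B0 w : (0 <= B w)%R.
  apply: mulr_ge0; first by rewrite mulr_ge0.
  by apply: sumr_ge0 => i _; exact: (forcing_ge0 drift).
pose C w := (A w * (c * (gamma (Y (-1) w) + K (Y (-1) w))) + B w)%R.
have C0 w : (0 <= C w)%R.
  by rewrite addr_ge0// mulr_ge0// mulr_ge0// addr_ge0// ltW.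
have osc w : oscillation_bound Q V (y w) n (a w ^+ m) (A w) (B w).
  (* The m blocks use m^3 of the n steps; on the other n - m^3 the oscillation is only bounded by
     1. *)
  have := @oscillation_blocks _ _ _ _ _ _ _ _ _ drift _ _ _ _ minor m
    (m ^ 2).-1 (y w) (n - m ^ 3) (a w) _ (a0 w).
  rewrite m2 m3 subnKC//; apply => k km.
  apply: (le_bigmax_seq _ k xpredT (fun k => alpha (y w k))) => //.
  by rewrite mem_index_iota.
have pointwise w : \int[mu w]_x quenched Q D n (y w) x <=
    \int[nu w]_x quenched Q D n (y w) x + ((b w)%:E + (C w)%:E).
  (* No common part of the two starting laws is assumed, hence again a = 1: the oscillation bound is
     merely integrated. *)
  have triv (m' : {measure set TX -> \bar R}) D' : measurable D' ->
      (1 - 1)%:E * mu w D' <= m' D'.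
    by rewrite subrr mul0e.
  have := integral_oscillation_bound drift (mu1 w) (nu1 w) (mu1 w)
    (_ : (0 <= 1 <= 1)%R) (triv (mu w)) (triv (nu w)) (exprn_ge0 m (a0 w))
    (A0 w) (B0 w) mD (osc w).
  rewrite ler01 lexx mul1r => /(_ isT)/le_trans; apply.
  rewrite -addeA leeD2l//.
  apply: le_trans (leeD2l _ (lee_wpmul2l _ (muV w))) _; first by rewrite lee_fin.
  have abw : (a w ^+ m <= b w)%R.
    apply: (exprn_bigmax_le (f := fun k => alpha (y w k))) => //.
    by rewrite expn_gt0 m0.
  by rewrite -EFinM -!EFinD lee_fin /C; lra.
have mb : measurable_fun setT b.
  apply: measurable_fun_bigmaxr => k; apply: measurable_funX.
  exact: measurableT_comp.
have mC : measurable_fun setT C.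
  have mg q : measurable_fun setT (fun w => growth gamma (y w) q).
    by apply: measurable_prod => k _; exact: measurableT_comp.
  have mf p q : measurable_fun setT (fun w => forcing gamma K (y w) p q).
    apply: measurable_sum => i; apply: measurable_funM.
      exact: measurableT_comp.
    by apply: measurable_prod => k _; exact: measurableT_comp.
  apply: measurable_funD.
    apply: measurable_funM; first by apply: measurable_funM => //; exact: measurable_sum.
    apply: measurable_funM => //.
    by apply: measurable_funD; exact: measurableT_comp.
  by apply: measurable_funM => //; exact: measurable_sum.
have q0 (m' : Omega -> {measure set TX -> \bar R}) w :
    0 <= \int[m' w]_x quenched Q D n (y w) x.
  by apply: integral_ge0 => x _; exact: quenched_ge0.
apply: (@le_trans _ _ (\int[P]_w (\int[nu w]_x quenched Q D n (y w) x +
    ((b w)%:E + (C w)%:E)))).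
  apply: ge0_le_integral => //.
  apply: emeasurable_funD => //.
  by apply: emeasurable_funD; exact/measurable_EFinP.
rewrite ge0_integralD//; last 2 first.
- by move=> w _; rewrite adde_ge0// lee_fin.
- by apply: emeasurable_funD; exact/measurable_EFinP.
rewrite leeD2l// ge0_integralD//; last 4 first.
- by move=> w _; rewrite lee_fin.
- exact/measurable_EFinP.
- by move=> w _; rewrite lee_fin.
- exact/measurable_EFinP.
rewrite /coupling_failure unlock leeD2l//.
exact: (annealed_bound statY mgamma gamma0 mK K1 r01 moment_le).
Qed.

End annealed_contraction.

(** * Total variation and setwise limits *)

(** For a Hahn decomposition A, B of mu1 - mu2 the total mass is (mu1 A - mu2 A) + (mu2 B - mu1 B),
    whence the factor 2. *)
Lemma dTV_le d (T : measurableType d) (R : realType) (mu1 mu2 : probability T R)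
    (e : \bar R) :
  (forall A, measurable A -> mu1 A <= mu2 A + e) ->
  (forall A, measurable A -> mu2 A <= mu1 A + e) -> dTV mu1 mu2 <= 2%:E * e.
Proof.
move=> mu12 mu21.
pose nu := cadd (charge_of_finite_measure mu1) (copp (charge_of_finite_measure mu2)).
have [A [B nuAB]] := Hahn_decomposition nu.
have [[mA _] [mB _] _ _] := nuAB.
rewrite /dTV (total_variation_massE nuAB) /charge_variation/=.
have -> : jordan_pos nuAB setT = mu1 A - mu2 A.
  by rewrite jordan_posE cjordan_posE /crestr0 /= ifT ?inE// /crestr setTI.
have -> : jordan_neg nuAB setT = - (mu1 B - mu2 B).
  by rewrite jordan_negE cjordan_negE /crestr0 /= ifT ?inE// /crestr setTI.
have -> : 2%:E * e = e + e by rewrite mule_natl mule2n.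
rewrite fin_num_oppeB ?fin_num_measure// [- mu1 B + _]addeC.
by apply: leeD; rewrite leeBlDl ?fin_num_measure// ?mu12// mu21.
Qed.

Section setwise_limit.
Context d (T : measurableType d) (R : realType).
Variables (mu : nat -> probability T R) (s : nat -> R) (n0 : nat).
Hypotheses (s0 : s @ \oo --> 0%R)
  (mu_cauchy : forall N M A, (n0 <= N)%N -> (N <= M)%N -> measurable A ->
    (`|fine (mu N A) - fine (mu M A)| <= s N)%R).

Let p n A : R := fine (mu n A).

Let cvg_p A : measurable A -> cvgn (p ^~ A).
Proof.
move=> mA; apply/cauchy_cvgP/cauchy_exP => e e0.
have [N _ sN] : \forall n \near \oo, (s n < e)%R.
  by move/cvgrPdist_lt : s0 => /(_ _ e0); apply: filterS => n;
    rewrite sub0r normrN; exact: le_lt_trans (ler_norm _).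
exists (p (maxn N n0) A); exists (maxn N n0) => // M /= NM.
rewrite /ball /=; apply: le_lt_trans (mu_cauchy _ NM mA) _.
  exact: leq_maxr.
by apply: sN; rewrite /= leq_maxl.
Qed.

Let q A : R := limn (p ^~ A).

Let p_le1 n A : measurable A -> (0 <= p n A <= 1)%R.
Proof.
move=> mA; rewrite fine_ge0//= -lee_fin fineK ?fin_num_measure//.
exact: probability_le1.
Qed.

Let q_ge0 A : measurable A -> (0 <= q A)%R.
Proof.
move=> mA; apply: limr_ge; first exact: cvg_p.
by apply: nearW => n; case/andP: (p_le1 n mA).
Qed.

Let p_near_q N A : (n0 <= N)%N -> measurable A -> (`|p N A - q A| <= s N)%R.
Proof.
move=> nN mA; rewrite distrC ler_distl; apply/andP; split.
  apply: limr_ge; first exact: cvg_p.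
  exists N => // M /= NM; have := mu_cauchy nN NM mA.
  by rewrite ler_distl => /andP[_]; rewrite -/(p N A) -/(p M A); lra.
apply: limr_le; first exact: cvg_p.
exists N => // M /= NM; have := mu_cauchy nN NM mA.
by rewrite ler_distl => /andP[+ _]; rewrite -/(p N A) -/(p M A); lra.
Qed.

Let pU n A B : measurable A -> measurable B -> A `&` B = set0 ->
  p n (A `|` B) = (p n A + p n B)%R.
Proof.
by move=> mA mB AB0; rewrite /p measureU// fineD// fin_num_measure.
Qed.

Let qU A B : measurable A -> measurable B -> A `&` B = set0 ->
  q (A `|` B) = (q A + q B)%R.
Proof.
move=> mA mB AB0; apply: cvg_lim => //.
under eq_fun do rewrite pU//.
by apply: cvgD; exact: cvg_p.
Qed.

Let q_setT : q setT = 1%R.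
Proof.
apply: cvg_lim => //; under eq_fun do rewrite /p probability_setT.
exact: cvg_cst.
Qed.

Let q_set0 : q set0 = 0%R.
Proof.
apply: cvg_lim => //; under eq_fun do rewrite /p measure0.
exact: cvg_cst.
Qed.

(** A measure is nonnegative on all sets, whereas the limit is controlled on measurable ones only;
    the maximum changes nothing there. *)
Definition setwise_limit (A : set T) : \bar R := (Num.max 0 (q A))%:E.

Let nu := setwise_limit.

Let nuE A : measurable A -> nu A = (q A)%:E.
Proof. by move=> mA; rewrite /nu /setwise_limit (max_idPr (q_ge0 mA)). Qed.

Let nu0 : nu set0 = 0.
Proof. by rewrite nuE// q_set0. Qed.

Let nu_ge0 A : 0 <= nu A.
Proof. by rewrite /nu lee_fin le_max lexx. Qed.

(** The convergence is uniform over measurable sets, so one index [M] serves all finite unions and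
    the full union at once; countable additivity of [mu M] supplies the last e / 3. *)
Let nu_sigma_additive : semi_sigma_additive nu.
Proof.
move=> F mF tF mUF.
have mU n : measurable (\big[setU/set0]_(0 <= i < n) F i).
  by apply: bigsetU_measurable.
have sumE n : \sum_(0 <= i < n) nu (F i) =
    (q (\big[setU/set0]_(0 <= i < n) F i))%:E.
  elim: n => [|n IHn]; first by rewrite !big_nil q_set0.
  have FI : \big[setU/set0]_(0 <= i < n) F i `&` F n = set0.
    rewrite big_mkord (@trivIset_bigsetUI _ xpredT)//.
    by apply: sub_trivIset tF.
  by rewrite !big_nat_recr//= IHn nuE// (qU (mU n) (mF n) FI).
under eq_fun do rewrite sumE.
rewrite nuE//; apply: cvg_EFin; first by near=> n.
apply/cvgrPdist_le => /= e e0.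
have [N _ sN] : \forall n \near \oo, (s n <= e / 3)%R.
  have e3 : (0 < e / 3)%R by rewrite divr_gt0.
  by move/cvgrPdist_le : s0 => /(_ _ e3); apply: filterS => n;
    rewrite sub0r normrN; exact: le_trans (ler_norm _).
pose M := maxn N n0.
have nM : (n0 <= M)%N by exact: leq_maxr.
have sM : (s M <= e / 3)%R by apply: sN; exact: leq_maxl.
have : p M (\big[setU/set0]_(0 <= i < n) F i) @[n --> \oo] --> p M (\bigcup_i F i).
  apply: fine_cvg; rewrite fineK ?fin_num_measure//.
  have := @measure_semi_sigma_additive _ _ _ (mu M) F mF tF mUF.
  apply: cvg_trans; apply: near_eq_cvg; near=> n.
  by rewrite big_mkord measure_bigsetU// big_mkord.
move=> /cvgrPdist_le/(_ (e / 3)%R).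
rewrite divr_gt0// => /(_ isT); apply: filterS => n.
have := p_near_q nM (mU n); have := p_near_q nM mUF.
rewrite !ler_distl => /andP[? ?] /andP[? ?] /andP[? ?].
by apply/andP; split; lra.
Unshelve. all: by end_near. Qed.

HB.instance Definition _ := isMeasure.Build _ _ _ nu nu0 nu_ge0 nu_sigma_additive.

Let nu_setT : nu setT = 1.
Proof. by rewrite nuE// q_setT. Qed.

HB.instance Definition _ := Measure_isProbability.Build _ _ _ nu nu_setT.

Lemma setwise_limit_exists : exists nu : probability T R,
  forall N A, (n0 <= N)%N -> measurable A ->
  (`|fine (mu N A) - fine (nu A)| <= s N)%R.
Proof.
exists nu => N A nN mA; have := p_near_q nN mA.
by rewrite -[q A]/(fine (q A)%:E) -nuE.
Qed.

End setwise_limit.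

(** * Rates *)

Section rates.
Local Open Scope ring_scope.
Context (R : realType).

Lemma floor_cbrt_itv n :
  (floor_cbrt R n)%:R <= n%:R `^ (1 / 3) :> R /\
  n%:R `^ (1 / 3) < (floor_cbrt R n)%:R + 1 :> R.
Proof.
rewrite /floor_cbrt div1r natr1.
by have /andP[] := truncn_itv (powR_ge0 n%:R (3^-1 : R)).
Qed.

Lemma powR_third_exprn n k : (n%:R `^ (1 / 3)) ^+ k = n%:R `^ (k%:R / 3) :> R.
Proof.
by rewrite -powR_mulrn ?powR_ge0// -powRrM; congr powR; field.
Qed.

Lemma floor_cbrt_le n : (floor_cbrt R n ^ 3 <= n)%N.
Proof.
rewrite -(ler_nat R) natrX.
apply: (@le_trans _ _ ((n%:R `^ (1 / 3)) ^+ 3)).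
  by rewrite lerXn2r ?nnegrE ?powR_ge0//; case: (floor_cbrt_itv n).
by rewrite powR_third_exprn divff// powRr1.
Qed.

Lemma floor_cbrt_gt0 n : (0 < n)%N -> (0 < floor_cbrt R n)%N.
Proof.
move=> n0; rewrite -(ltr_nat R) -(ltrD2r 1) add0r.
apply: le_lt_trans (proj2 (floor_cbrt_itv n)).
apply: (@le_trans _ _ (1 `^ (1 / 3))); first by rewrite powR1.
by rewrite ge0_ler_powR ?nnegrE ?ler1n// divr_ge0.
Qed.

Lemma le_exprn_expR (x : R) k : 0 <= x -> (x / k.+1%:R) ^+ k.+1 <= expR x.
Proof.
move=> x0; have k0 : (0 : R) < k.+1%:R by [].
have -> : expR x = expR (x / k.+1%:R) ^+ k.+1.
  by rewrite -expRM_natl mulrC divfK// lt0r_neq0.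
rewrite lerXn2r ?nnegrE ?expR_ge0 ?divr_ge0//.
by apply: le_trans (expR_ge1Dx _); rewrite lerDr.
Qed.

(** The decay at hand is exponential in m^2, but only decay exponential in n^(1/3) is claimed, and
    the surplus absorbs the polynomial factors. The first clause serves the [n] for which no moment
    bound is available yet. *)
Lemma escape_rate (eps r C : R) (n0 : nat) :
  0 < eps -> 0 < r -> (1 + eps) * r < 1 -> 0 <= C ->
  exists c nu : R, [/\ 0 < c, 0 < nu & forall n, (0 < n)%N ->
    let m := floor_cbrt R n in
    let rate := c * n%:R `^ (2 / 3) * expR (- nu * n%:R `^ (1 / 3)) in
    ((m ^ 2 < n0)%N -> 1 <= rate) /\
    2 * (eps / 2 * (1 + eps) ^+ (m ^ 2).-1) * (C + m%:R * (m ^ 2)%:R) * m%:R *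
      r ^+ (m ^ 2) <= rate].
Proof.
move=> eps0 r0 rho1 C0.
have e1 : 0 < 1 + eps by rewrite addr_gt0.
have alg (u v w M : R) :
    2 * (eps / 2 * u) * w * M * v = eps * (w * M) * (u * v) by field.
have [eps_ge0 r_ge0 e_ge0] := And3 (ltW eps0) (ltW r0) (ltW e1).
pose rho := (1 + eps) * r.
have rho0 : 0 < rho by rewrite mulr_gt0.
have [nu nu0 rhoE] : exists2 nu : R, 0 < nu &
    forall k, rho ^+ k = expR (- (4 * nu * k%:R)).
  (* With rho^(m^2) = exp(- 4 nu m^2), the exponential splits into two equal halves: one bounds a
     factor m^2 by 1 / (2 nu), the other gives exp(- nu x), as x < m + 1 <= 2 m^2. *)
  exists (- ln rho / 4) => [|k]; first by rewrite divr_gt0// oppr_gt0 ln_lt0// rho0.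
  rewrite -[rho in LHS](lnK rho0) -expRM_natl; congr expR.
  by field.
have nu_ge0 := ltW nu0.
have C1 : 0 <= C + 1 by rewrite addr_ge0.
(* The first summand pays for the escape term; the second makes the rate at least 1 as long as m^2 <
   n0, where x <= n0 + 1. *)
pose c := eps * (C + 1) / (2 * nu) + expR (nu * (n0%:R + 1)).
have c1 : 0 <= eps * (C + 1) / (2 * nu).
  by rewrite divr_ge0 ?mulr_ge0.
exists c, nu; split => //; first by rewrite ltr_wpDl// expR_gt0.
move=> n n_gt0 m rate.
have [mx xm] := floor_cbrt_itv n; rewrite -/m in mx xm.
set x := n%:R `^ (1 / 3) in mx xm.
have m1 : (1 : R) <= m%:R by rewrite ler1n floor_cbrt_gt0.
have x1 : 1 <= x by exact: le_trans mx.
have rateE : rate = c * x ^+ 2 * expR (- (nu * x)).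
  by rewrite /rate powR_third_exprn mulNr.
rewrite rateE; split.
  move=> mn0.
  have xn0 : x <= n0%:R + 1.
    rewrite (le_trans (ltW xm))// lerD2r ler_nat.
    by rewrite (leq_trans _ (ltnW mn0))// -mulnn leq_pmulr// floor_cbrt_gt0.
  have cx : expR (nu * x) <= c.
    apply: (@le_trans _ _ (expR (nu * (n0%:R + 1)))); last by rewrite lerDr.
    by rewrite ler_expR ler_pM2l.
  rewrite expRN ler_pdivlMr ?expR_gt0// mul1r (le_trans cx)// ler_peMr//.
    by rewrite (le_trans _ cx)// expR_ge0.
  exact: exprn_ege1.
rewrite natrX; set M := m%:R : R.
have M0 : 0 <= M by rewrite (le_trans ler01).
have rhoM : (1 + eps) ^+ (m ^ 2).-1 * r ^+ (m ^ 2) <= expR (- (4 * nu * M ^+ 2)).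
  rewrite -natrX -rhoE /rho exprMn ler_wpM2r ?exprn_ge0//.
  by rewrite ler_weXn2l ?lerDl ?leq_pred.
have poly : (C + M * M ^+ 2) * M <= (C + 1) * M ^+ 4.
  have M3 : 1 <= M ^+ 3 by exact: exprn_ege1.
  have -> : (C + 1) * M ^+ 4 = (C * M ^+ 3 + M * M ^+ 2) * M by ring.
  by rewrite ler_wpM2r// lerD2r ler_peMr.
have M2 : M ^+ 2 * expR (- (2 * nu * M ^+ 2)) <= (2 * nu)^-1.
  rewrite expRN ler_pdivrMr ?expR_gt0// ler_pdivlMl ?mulr_gt0//.
  by apply: le_trans (expR_ge1Dx _); rewrite lerDr.
have E2 : expR (- (2 * nu * M ^+ 2)) <= expR (- (nu * x)).
  rewrite ler_expR lerN2 [2 * nu]mulrC -mulrA ler_pM2l//.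
  rewrite (le_trans (ltW xm))// -/M.
  have MM : M <= M ^+ 2 by rewrite expr2 ler_peMr.
  by rewrite [leRHS]mulr_natl mulr2n lerD// exprn_ege1.
have Mx : M ^+ 2 <= x ^+ 2 by rewrite lerXn2r ?nnegrE// (le_trans M0).
apply: (@le_trans _ _ (eps * ((C + M * M ^+ 2) * M) *
    ((1 + eps) ^+ (m ^ 2).-1 * r ^+ (m ^ 2)))).
  by rewrite alg.
apply: (@le_trans _ _ (eps * ((C + 1) * M ^+ 4) * expR (- (4 * nu * M ^+ 2)))).
  apply: ler_pM => //.
  - by rewrite mulr_ge0// mulr_ge0// addr_ge0// mulr_ge0// exprn_ge0.
  - by rewrite mulr_ge0 ?exprn_ge0.
  - by rewrite ler_pM2l.
have -> : expR (- (4 * nu * M ^+ 2)) =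
    expR (- (2 * nu * M ^+ 2)) * expR (- (2 * nu * M ^+ 2)).
  by rewrite -expRD; congr expR; ring.
have -> : eps * ((C + 1) * M ^+ 4) *
    (expR (- (2 * nu * M ^+ 2)) * expR (- (2 * nu * M ^+ 2))) =
    eps * (C + 1) * (M ^+ 2 * expR (- (2 * nu * M ^+ 2))) *
    (M ^+ 2 * expR (- (2 * nu * M ^+ 2))) by ring.
rewrite -[leRHS]mulrA; apply: ler_pM.
- by rewrite mulr_ge0 ?mulr_ge0 ?expR_ge0 ?exprn_ge0.
- by rewrite mulr_ge0 ?expR_ge0 ?exprn_ge0.
- apply: (@le_trans _ _ (eps * (C + 1) / (2 * nu))); last by rewrite lerDl expR_ge0.
  by rewrite ler_wpM2l// mulr_ge0.
- by apply: ler_pM => //; rewrite ?exprn_ge0 ?expR_ge0.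
Qed.

End rates.

(** Comparison with a telescoping sum: 1 / p^2 <= 2 / (p (p + 1)) = 2 / p - 2 / (p + 1). *)
Lemma nneseries_lty_inv_sqr (R : realType) (f : nat -> \bar R) (D : R) (n0 : nat) :
  (forall n, 0 <= f n < +oo) -> (0 < n0)%N -> (0 <= D)%R ->
  (forall n, (n0 <= n)%N -> f n <= (D / n%:R ^+ 2)%:E) ->
  \sum_(0 <= n <oo) f n < +oo.
Proof.
move=> f0 n0_gt0 D0 fD.
have fge0 n : 0 <= f n by case/andP: (f0 n).
rewrite (nneseries_split 0 n0)// add0n; apply: lte_add_pinfty.
  by apply: lte_sum_pinfty => i _; case/andP: (f0 i).
apply: (@le_lt_trans _ _ (2 * D)%:E); last exact: ltry.
apply: lime_le; first exact: is_cvg_nneseries.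
apply: nearW => n; have [nn0|nn0] := leqP n n0.
  by rewrite big_geq// lee_fin mulr_ge0.
have n_gt0 k : (n0 <= k)%N -> (0 < k%:R :> R)%R.
  by move=> /(leq_trans n0_gt0); rewrite ltr0n.
suff H p : (n0 <= p)%N ->
    \sum_(n0 <= i < p) f i <= (D * (2 / n0%:R - 2 / p%:R))%:E.
  apply: le_trans (H _ (ltnW nn0)) _; rewrite lee_fin [leRHS]mulrC ler_wpM2l//.
  rewrite lerBlDr ler_wpDr ?divr_ge0//.
  by rewrite ler_pdivrMr ?n_gt0// ler_peMr// ler1n.
elim: p => [|p IHp]; first by rewrite leqn0 => /eqP n00; rewrite n00 in n0_gt0.
rewrite leq_eqVlt => /predU1P[<-|]; first by rewrite big_geq// subrr mulr0.
rewrite ltnS => n0p; rewrite big_nat_recr//=.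
apply: le_trans (leeD (IHp n0p) (fD _ n0p)) _; rewrite -EFinD lee_fin -mulrDr.
rewrite ler_wpM2l//; have p0 := n_gt0 _ n0p.
have p10 : (0 < p%:R + 1 :> R)%R by rewrite addr_gt0.
have pp : (1 <= p%:R :> R)%R by rewrite ler1n (leq_trans n0_gt0).
have key : ((p%:R ^+ 2)^-1 <= 2 / p%:R - 2 / (p%:R + 1) :> R)%R.
  rewrite (_ : 2 / p%:R - 2 / (p%:R + 1) = 2 / (p%:R * (p%:R + 1)))%R; last first.
    by field; rewrite !lt0r_neq0.
  rewrite ler_pdivlMr ?mulr_gt0// mulrC ler_pdivrMr ?exprn_gt0//.
  have pp2 : (p%:R <= p%:R ^+ 2 :> R)%R by rewrite expr2 ler_peMr// ltW.
  by rewrite mulrDr mulr1 -expr2 [leRHS]mulr_natl mulr2n lerD2l.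
by rewrite -[p.+1%:R]natr1; lra.
Qed.

(** * Summability of the coupling failures under the smallness condition *)

Section summability.
Context d (Omega : measurableType d) (R : realType) (P : probability Omega R)
  dY (TY : measurableType dY) (Y : int -> {mfun Omega >-> TY}) (alpha : TY -> R).
Hypotheses (statY : strictly_stationary P Y) (malpha : measurable_fun setT alpha)
  (alpha01 : forall z, (0 <= alpha z <= 1)%R) (small : smallness_condition P Y alpha).

Definition alpha_moment k : R := fine 'E_P[fun w => (alpha (Y 0 w) ^+ k)%R].

Let malphaX h k : measurable_fun setT (fun w => alpha (Y h w) ^+ k)%R.
Proof. by apply: measurable_funX; exact: measurableT_comp. Qed.

Let alphaX01 z k : (0 <= alpha z ^+ k <= 1)%R.
Proof.
by have /andP[a0 a1] := alpha01 z; rewrite exprn_ge0// exprn_ile1.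
Qed.

Let expectation_le1 (f : Omega -> R) : measurable_fun setT f ->
  (forall w, 0 <= f w <= 1)%R -> 0 <= 'E_P[f] <= 1.
Proof.
move=> mf f01; rewrite expectation_ge0/=; last by move=> w; case/andP: (f01 w).
rewrite unlock -(probability_setT P) -[leRHS]mul1e -integral_cst//.
apply: ge0_le_integral => //.
- by move=> w _; rewrite lee_fin; case/andP: (f01 w).
- exact/measurable_EFinP.
- by move=> w _; rewrite lee_fin; case/andP: (f01 w).
Qed.

Let alpha_momentE h k : \int[P]_w (alpha (Y h w) ^+ k)%:E = (alpha_moment k)%:E.
Proof.
rewrite /alpha_moment fineK; last first.
  have /andP[E0 E1] : 0 <= 'E_P[fun w => (alpha (Y 0 w) ^+ k)%R] <= 1.
    exact: expectation_le1.
  by rewrite ge0_fin_numE// (le_lt_trans E1)// ltry.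
rewrite unlock.
pose f (e : 1.-tuple TY) : \bar R := (alpha (tnth e ord0) ^+ k)%:E.
transitivity (\int[P]_w f [tuple Y (Posz i + h)%R w | i < 1]).
  by apply: eq_integral => w _; rewrite /f tnth_mktuple add0r.
rewrite stationary_integral//.
- by apply: eq_integral => w _; rewrite /f tnth_mktuple.
- apply/measurable_EFinP; apply: measurable_funX; apply: measurableT_comp => //.
  exact: measurable_tnth.
- by move=> e; rewrite lee_fin; case/andP: (alphaX01 (tnth e ord0) k).
Qed.

Let alpha_moment_ge0 k : (0 <= alpha_moment k)%R.
Proof.
rewrite -lee_fin -(alpha_momentE 0); apply: integral_ge0 => w _.
by rewrite lee_fin; case/andP: (alphaX01 (Y 0 w) k).
Qed.

Lemma coupling_failure_le1 m : 0 <= coupling_failure P Y alpha m <= 1.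
Proof.
apply: expectation_le1 => [|w]; first exact: measurable_fun_bigmaxr.
apply: (big_ind (fun t : R => (0 <= t <= 1)%R)) => //.
  by rewrite lexx ler01.
by move=> s t /andP[s0 s1] /andP[t0 t1]; rewrite le_max s0 ge_max s1 t1.
Qed.

(** A maximum of nonnegative terms is at most their sum, and by stationarity the m^3 summands have
    the same mean. *)
Lemma coupling_failure_le m :
  coupling_failure P Y alpha m <= ((m ^ 3)%:R * alpha_moment (m - 1))%:E.
Proof.
rewrite /coupling_failure unlock.
have a0 w k : (0 <= alpha (Y k w) ^+ (m - 1))%R.
  by case/andP: (alphaX01 (Y k w) (m - 1)).
apply: (@le_trans _ _ (\int[P]_w
    \sum_(0 <= k < m ^ 3) (alpha (Y (Posz k) w) ^+ (m - 1))%:E)).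
  apply: ge0_le_integral => //.
  - move=> w _; rewrite lee_fin; apply: (big_ind (fun t : R => (0 <= t)%R)) => //.
    by move=> s t s0 t0; rewrite le_max s0.
  - by apply/measurable_EFinP; exact: measurable_fun_bigmaxr.
  - by apply: emeasurable_sum => k; exact/measurable_EFinP.
  - move=> w _; rewrite sumEFin lee_fin.
    elim: (index_iota _ _) => [|k s IHs]; first by rewrite !big_nil.
    rewrite !big_cons ge_max lerDl sumr_ge0//=.
    by rewrite (le_trans IHs)// lerDr.
rewrite ge0_integral_sum//; last 2 first.
- by move=> k; exact/measurable_EFinP.
- by move=> k w _; rewrite lee_fin.
under eq_bigr do rewrite alpha_momentE.
by rewrite sumEFin sumr_const_nat subn0 lee_fin mulr_natl.
Qed.

(** The normalized root tends to 0, hence is eventually below exp(-1); raising it to the power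
    k^theta undoes the root. *)
Lemma alpha_moment_decay : exists theta : R, [/\ (0 < theta)%R &
  \forall k \near \oo, (alpha_moment k <= expR (- k%:R `^ theta))%R].
Proof.
case: small => theta /andP[theta0 _] cvg0; exists theta; split => //.
have E0 : ((fun n => (alpha_moment n `^ (n%:R `^ theta)^-1)%R) @ \oo --> (0 : R))%R.
  apply: cvg_trans (fine_cvg cvg0); apply: near_eq_cvg; apply: nearW => n /=.
  by rewrite unlock alpha_momentE poweR_EFin.
near=> k.
have k0 : (0 < k)%N by near: k; exact: nbhs_infty_gt.
have p0 : (0 < k%:R `^ theta :> R)%R by rewrite powR_gt0// ltr0n.
have lt1 : (alpha_moment k `^ (k%:R `^ theta)^-1 <= expR (- 1))%R.
  near: k; move/cvgrPdist_le : E0 => /(_ _ (expR_gt0 (- 1))).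
  by apply: filterS => n; rewrite sub0r normrN; exact: le_trans (ler_norm _).
have -> : alpha_moment k =
    ((alpha_moment k `^ (k%:R `^ theta)^-1) `^ (k%:R `^ theta))%R.
  by rewrite -powRrM mulVf ?lt0r_neq0// powRr1.
apply: (@le_trans _ _ (expR (- 1) `^ (k%:R `^ theta)))%R.
  by rewrite ge0_ler_powR ?nnegrE ?powR_ge0 ?expR_ge0// ltW.
by rewrite -expRM mulN1r.
Unshelve. all: by end_near. Qed.

Lemma coupling_failure_decay : exists D : R, (0 <= D)%R /\
  \forall n \near \oo,
    coupling_failure P Y alpha (floor_cbrt R n) <= (D / n%:R ^+ 2)%:E.
Proof.
have [theta [theta0 [k0 _ decay]]] := alpha_moment_decay.
(* With theta J >= 9, exp(- k^theta) is at most J^J / k^9. Nine powers are needed: three for the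
   factor m^3 and six for n^2 = x^6. *)
pose J := (Num.truncn (9 / theta)).+1.
have J9 : (9 <= theta * J%:R)%R.
  have /andP[_ /ltW] := truncn_itv (divr_ge0 (ler0n R 9) (ltW theta0)).
  by rewrite -/J ler_pdivrMr// mulrC.
(* The factor 4^9 comes from x <= 4 (m - 1). The threshold on [n] below ensures that m - 1 is
   positive and in the range of [decay]. *)
exists (J%:R ^+ J * 4 ^+ 9)%R; split; first by rewrite mulr_ge0 ?exprn_ge0.
exists ((k0 + 3) ^ 3)%N => // n /= kn.
apply: le_trans (coupling_failure_le _) _; rewrite lee_fin.
set m := floor_cbrt R n; have [mx xm] := floor_cbrt_itv R n.
rewrite -/m in mx xm; set x := (n%:R `^ (1 / 3))%R in mx xm.
have kx : ((k0 + 3)%:R <= x)%R.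
  rewrite -(@ler_pXn2r _ 3)// ?nnegrE ?powR_ge0// powR_third_exprn divff//.
  by rewrite powRr1// -natrX ler_nat.
have mk : (k0 + 3 <= m)%N.
  by rewrite -ltnS -(ltr_nat R) -natr1; exact: le_lt_trans xm.
set k := (m - 1)%N; have k2 : (k0.+2 <= k)%N.
  by have := leq_sub2r 1 mk; rewrite addn3 subn1.
have k0k : (k0 <= k)%N by exact: ltnW (ltnW k2).
have k1 : (1 <= k)%N by exact: leq_trans k2.
have k1R : (1 <= k%:R :> R)%R by rewrite ler1n.
have kgt0 : (0 < k%:R :> R)%R by exact: lt_le_trans k1R.
have kx4 : (x <= 4 * k%:R)%R.
  have mE : (m%:R = k%:R + 1 :> R)%R.
    by rewrite natr1 /k subn1 prednK// (leq_trans _ mk)// addn3.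
  by move: xm; rewrite mE; lra.
have xgt0 : (0 < x)%R by apply: lt_le_trans kx; rewrite ltr0n addn3.
have x6 : (x ^+ 6 = n%:R ^+ 2)%R.
  rewrite powR_third_exprn (_ : 6 / 3 = 2%:R)%R ?powR_mulrn//.
  by field.
have JgtO : (0 < J%:R :> R)%R by [].
have dec : (alpha_moment k <= J%:R ^+ J * 4 ^+ 9 / x ^+ 9)%R.
  apply: le_trans (decay k k0k) _; rewrite expRN.
  have le9 : (k%:R ^+ 9 <= (k%:R `^ theta) ^+ J :> R)%R.
    have <- : (k%:R `^ 9 = k%:R ^+ 9 :> R)%R by rewrite powR_mulrn.
    have <- : (k%:R `^ (theta * J%:R) = (k%:R `^ theta) ^+ J :> R)%R.
      by rewrite powRrM powR_mulrn ?powR_ge0.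
    by rewrite ler_powR.
  have xk : (x ^+ 9 <= 4 ^+ 9 * k%:R ^+ 9)%R.
    by rewrite -exprMn lerXn2r ?nnegrE ?mulr_ge0// ltW.
  have := le_exprn_expR (Num.truncn (9 / theta)) (powR_ge0 (k%:R : R) theta).
  rewrite -/J expr_div_n ler_pdivrMr ?exprn_gt0// => leE.
  rewrite ler_pdivlMr ?exprn_gt0// mulrC ler_pdivrMr ?expR_gt0//.
  apply: (le_trans xk); rewrite [leRHS]mulrAC mulrC ler_pM2r ?exprn_gt0//.
  by rewrite (le_trans le9)// mulrC.
rewrite -x6 (_ : J%:R ^+ J * 4 ^+ 9 / x ^+ 6 =
  x ^+ 3 * (J%:R ^+ J * 4 ^+ 9 / x ^+ 9))%R; last first.
  move: (J%:R ^+ J)%R (4 ^+ 9 : R)%R => u v.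
  by field; rewrite lt0r_neq0.
rewrite natrX; apply: ler_pM => //.
by rewrite lerXn2r ?nnegrE// ltW.
Qed.

End summability.

Lemma stretched_exponential_decay (R : realType) (c nu : R) :
  (0 <= c)%R -> (0 < nu)%R ->
  exists D : R, (0 <= D)%R /\ forall n, (0 < n)%N ->
  (c * n%:R `^ (2 / 3) * expR (- nu * n%:R `^ (1 / 3)) <= D / n%:R ^+ 2)%R.
Proof.
(* Eight powers of x: two for n^(2/3) and six for n^2. *)
move=> c0 nu0; exists (c * (8 / nu) ^+ 8)%R; split.
  by rewrite mulr_ge0// exprn_ge0// divr_ge0// ltW.
move=> n n0; set x := (n%:R `^ (1 / 3))%R.
have xgt0 : (0 < x)%R by rewrite powR_gt0// ltr0n.
have -> : (n%:R `^ (2 / 3) = x ^+ 2)%R by rewrite powR_third_exprn.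
have <- : (x ^+ 6 = n%:R ^+ 2)%R.
  rewrite powR_third_exprn (_ : 6 / 3 = 2%:R)%R ?powR_mulrn//.
  by field.
rewrite mulNr expRN ler_pdivrMr ?expR_gt0//.
have nx : (0 <= nu * x)%R by rewrite mulr_ge0// ltW.
apply: (@le_trans _ _ (c * (8 / nu) ^+ 8 / x ^+ 6 * (nu * x / 8) ^+ 8))%R.
  rewrite le_eqVlt; apply/orP; left; apply/eqP.
  by field; rewrite !lt0r_neq0.
apply: ler_wpM2l; last exact: (le_exprn_expR 7 nx).
have D0 : (0 <= 8 / nu)%R by rewrite divr_ge0// ltW.
apply: divr_ge0; last exact: exprn_ge0 (ltW xgt0).
by rewrite mulr_ge0// exprn_ge0.
Qed.

(** * Convergence of the laws *)

Lemma gammabar_moment_le (R : realType) d (Omega : measurableType d)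
    (P : probability Omega R) dY (TY : measurableType dY)
    (Y : int -> {mfun Omega >-> TY}) (gamma K : TY -> R) (eps : R)
    (gbar := fine (gammabar P Y gamma K)) :
  (forall y, 0 < gamma y)%R -> (forall y, 1 <= K y)%R ->
  gammabar P Y gamma K < 1 -> (0 < gbar)%R ->
  (0 < eps < 1 / Num.sqrt gbar - 1)%R ->
  exists r n0, [/\ (0 < r)%R, (r <= 1)%R, ((1 + eps) * r < 1)%R &
    forall q, (n0 <= q)%N -> drift_moment P Y gamma K q <= (r ^+ q)%:E].
Proof.
move=> gamma0 K1 g1 gbar0 /andP[eps0 epsg].
have gE : gammabar P Y gamma K = gbar%:E.
  by move: gbar0; rewrite /gbar; case: (gammabar _ _ _ _) => //=; rewrite ltxx.
have gbar1 : (gbar < 1)%R by rewrite -lte_fin -gE.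
have e1 : (0 < 1 + eps)%R by rewrite addr_gt0.
have sg0 : (0 < Num.sqrt gbar)%R by rewrite sqrtr_gt0.
(* The condition on eps reads (1 + eps) sqrt gbar < 1; one further factor sqrt gbar < 1 gives the
   claim. *)
have eg1 : ((1 + eps) * gbar < 1)%R.
  have sg1 : (Num.sqrt gbar < 1)%R by rewrite -sqrtr1 ltr_sqrt.
  have lt1 : ((1 + eps) * Num.sqrt gbar < 1)%R.
    by rewrite -ltr_pdivlMr//; lra.
  have sE : (Num.sqrt gbar * Num.sqrt gbar = gbar)%R.
    by rewrite -expr2 sqr_sqrtr// ltW.
  have -> : ((1 + eps) * gbar = (1 + eps) * Num.sqrt gbar * Num.sqrt gbar)%R.
    by rewrite -mulrA sE.
  by rewrite mulr_ilt1 ?mulr_ge0 ?(ltW e1) ?(ltW sg0).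
pose r := ((gbar + (1 + eps)^-1) / 2)%R.
have ei : (gbar < (1 + eps)^-1)%R by rewrite -[ltRHS]mul1r ltr_pdivlMr// mulrC.
have ei1 : ((1 + eps)^-1 <= 1)%R by rewrite invf_le1// lerDl ltW.
have gr : (gbar < r)%R by rewrite /r; lra.
have r0 : (0 < r)%R by exact: lt_trans gr.
have re : (r < (1 + eps)^-1)%R by rewrite /r; lra.
pose u n := drift_moment P Y gamma K n `^ n%:R^-1.
have : ereal_inf (range (esups u)) < r%:E.
  have -> : ereal_inf (range (esups u)) = gammabar P Y gamma K.
    by rewrite /gammabar limn_esup_lim; apply/esym/cvg_lim => //; exact: cvg_esups_inf.
  by rewrite gE lte_fin.
move=> /ereal_inf_lt[_ [n0 _ <-] ur].
(* The successor excludes q = 0, where the root in the limsup has exponent 0 and cannot be undone.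
   Infinite moments are excluded at the end, as their roots are infinite too. *)
exists r, n0.+1; split => //.
- by rewrite ltW// (lt_le_trans re).
- by rewrite -ltr_pdivlMl// mulr1.
move=> q nq; have q0 : (0 < q)%N by exact: leq_trans nq.
have qR : (q%:R != 0 :> R)%R by rewrite pnatr_eq0 -lt0n.
have : u q < r%:E.
  apply: le_lt_trans ur; apply: ereal_sup_ubound; exists q => //=.
  exact: ltnW.
have : 0 <= drift_moment P Y gamma K q.
  apply: expectation_ge0 => w; apply: mulr_ge0; first exact: le_trans (K1 _).
  by apply: prodr_ge0 => k _; exact: ltW.
rewrite /u; case: (drift_moment _ _ _ _ _) => [a| |]//.
  rewrite poweR_EFin !lee_fin lte_fin => a0 ar.
  have -> : a = ((a `^ q%:R^-1) `^ q%:R)%R by rewrite -powRrM mulVf// powRr1.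
  rewrite -(powR_mulrn q (ltW r0)).
  by rewrite ge0_ler_powR ?nnegrE ?powR_ge0 ?(ltW r0) ?(ltW ar).
by rewrite poweRyr ?invr_eq0// ltNge leey.
Qed.

Section chain_convergence.
Context d (Omega : measurableType d) (R : realType) (P : probability Omega R)
  dX (TX : measurableType dX) dY (TY : measurableType dY)
  (Y : int -> {mfun Omega >-> TY}) (Q : R.-pker (TY * TX) ~> TX)
  (V : TX -> R) (gamma K : TY -> R) (gbar eps : R) (alpha : TY -> R)
  (kappa : R.-pker TY ~> TX) (r : R) (n0 : nat).
Hypotheses (statY : strictly_stationary P Y) (drift : drift_condition Q V gamma K)
  (minor : minorization_condition Q V gamma K gbar eps alpha kappa)
  (small : smallness_condition P Y alpha)
  (r0 : (0 < r)%R) (r1 : (r <= 1)%R) (er1 : ((1 + eps) * r < 1)%R)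
  (moment_le : forall q, (n0 <= q)%N -> drift_moment P Y gamma K q <= (r ^+ q)%:E).

Let eps0 : (0 < eps)%R. Proof. by case: minor => -[_ /andP[]]. Qed.
Let malpha : measurable_fun setT alpha. Proof. by case: minor => _ []. Qed.
Let alpha01 z : (0 <= alpha z <= 1)%R.
Proof. by case: minor => _ [_ /(_ z)/andP[-> /ltW]]. Qed.
Let mV : measurable_fun setT V. Proof. by case: drift => -[]. Qed.
Let V0 x : (0 <= V x)%R. Proof. by case: drift => -[]. Qed.
Let K1 y : (1 <= K y)%R. Proof. by case: drift => _ _ []. Qed.
Let gamma0 y : (0 < gamma y)%R. Proof. by case: drift => _ []. Qed.

Let y w k := Y (Posz k) w.

Definition step_bound (c nu : R) (n : nat) : \bar R :=
  coupling_failure P Y alpha (floor_cbrt R n) +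
  (c * n%:R `^ (2 / 3) * expR (- nu * n%:R `^ (1 / 3)))%:E.

Lemma step_bound_ge0 c nu n : (0 < c)%R -> 0 <= step_bound c nu n.
Proof.
move=> c0; rewrite adde_ge0//; last first.
  by rewrite lee_fin mulr_ge0 ?expR_ge0// mulr_ge0 ?powR_ge0// ltW.
by case/andP: (coupling_failure_le1 P Y malpha alpha01 (floor_cbrt R n)).
Qed.

Lemma step_bound_summable c nu : (0 < c)%R -> (0 < nu)%R ->
  \sum_(0 <= n <oo) step_bound c nu n < +oo.
Proof.
move=> c0 nu0.
have [D1 [D10 [k0 _ cf]]] := coupling_failure_decay statY malpha alpha01 small.
have [D2 [D20 se]] := stretched_exponential_decay (ltW c0) nu0.
apply: (@nneseries_lty_inv_sqr _ _ (D1 + D2) k0.+1) => //.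
- move=> n; rewrite step_bound_ge0//= /step_bound.
  have /andP[_ le1] := coupling_failure_le1 P Y malpha alpha01 (floor_cbrt R n).
  by rewrite lte_add_pinfty ?ltry// (le_lt_trans le1)// ltry.
- exact: addr_ge0.
move=> n kn; rewrite mulrDl EFinD; apply: leeD; first by apply: cf; exact: ltnW.
by rewrite lee_fin; apply: se; exact: leq_trans kn.
Qed.

Definition step_tail (c nu : R) (N : nat) : \bar R := \sum_(N <= n <oo) step_bound c nu n.

Lemma step_tail_ge0 c nu N : (0 < c)%R -> 0 <= step_tail c nu N.
Proof. by move=> c0; apply: nneseries_ge0 => n _ _; exact: step_bound_ge0. Qed.

Lemma step_tail_fin_num c nu N : (0 < c)%R -> (0 < nu)%R -> step_tail c nu N \is a fin_num.
Proof.
move=> c0 nu0; rewrite ge0_fin_numE ?step_tail_ge0//.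
apply: le_lt_trans (step_bound_summable c0 nu0).
rewrite (nneseries_split 0 N) => [|k _]; last exact: step_bound_ge0.
by rewrite add0n leeDr// sume_ge0// => k _; exact: step_bound_ge0.
Qed.

Lemma step_tail_cvg0 c nu : (0 < c)%R -> (0 < nu)%R ->
  step_tail c nu N @[N --> \oo] --> (0 : \bar R).
Proof.
move=> c0 nu0; apply: nneseries_tail_cvg; first exact: step_bound_summable.
by move=> k _; exact: step_bound_ge0.
Qed.

Lemma step_bound_le_tail c nu n : (0 < c)%R -> step_bound c nu n <= step_tail c nu n.
Proof.
move=> c0; rewrite /step_tail (nneseries_split n 1) => [|k _]; last exact: step_bound_ge0.
by rewrite addn1 big_nat1 leeDl// step_tail_ge0.
Qed.

Lemma fine_step_tail_cvg0 c nu : (0 < c)%R -> (0 < nu)%R ->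
  fine (step_tail c nu N) @[N --> \oo] --> (0 : R)%R.
Proof. by move=> c0 nu0; apply: fine_cvg; exact: step_tail_cvg0. Qed.

(** The constants depend on the starting laws only through [C], so they are fixed before the laws,
    [n] and [D]. When m^2 < n0 the rate is at least 1 and exceeds any probability. *)
Lemma contraction_step (C : R) : (0 <= C)%R -> exists c nu : R,
  [/\ (0 < c)%R, (0 < nu)%R & forall (mu nu' : Omega -> {measure set TX -> \bar R}) n D,
  (0 < n)%N -> measurable D ->
  (forall w, mu w setT = 1) -> (forall w, nu' w setT = 1) ->
  (forall w, \int[mu w]_x (V x)%:E + \int[nu' w]_x (V x)%:E <=
    (C * (gamma (Y (-1) w) + K (Y (-1) w)))%:E) ->
  measurable_fun setT (fun w => \int[mu w]_x quenched Q D n (y w) x) ->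
  measurable_fun setT (fun w => \int[nu' w]_x quenched Q D n (y w) x) ->
  \int[P]_w \int[mu w]_x quenched Q D n (y w) x <=
  \int[P]_w \int[nu' w]_x quenched Q D n (y w) x + step_bound c nu n].
Proof.
move=> C0; have [c [nu [c0 nu0 rates]]] := escape_rate n0 eps0 r0 er1 C0.
exists c, nu; split => // mu nu' n D n_gt0 mD mu1 nu1 muV mmu mnu.
have [rate1 rate2] := rates n n_gt0.
have q0 (m' : Omega -> {measure set TX -> \bar R}) :
    0 <= \int[P]_w \int[m' w]_x quenched Q D n (y w) x.
  by apply: integral_ge0 => w _; apply: integral_ge0 => x _; exact: quenched_ge0.
have /andP[cf0 _] := coupling_failure_le1 P Y malpha alpha01 (floor_cbrt R n).
have [n0m|mn0] := leqP n0 (floor_cbrt R n ^ 2).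
  have r01 : (0 <= r <= 1)%R by rewrite r1 ltW.
  apply: le_trans (annealed_contraction statY drift minor r01 moment_le
    (floor_cbrt_gt0 R n_gt0) (floor_cbrt_le R n) n0m C0 mD mu1 nu1 muV mmu mnu) _.
  by rewrite leeD2l// leeD2l// lee_fin.
apply: (@le_trans _ _ 1).
  rewrite -[leRHS](@probability_setT _ _ _ P) -[leRHS]mul1e -integral_cst//.
  apply: ge0_le_integral => //.
  - by move=> w _; apply: integral_ge0 => x _; exact: quenched_ge0.
  - move=> w _; rewrite /= -(mu1 w) -[leRHS]mul1e -integral_cst//.
    apply: ge0_le_integral => //.
    + by move=> x _; exact: quenched_ge0.
    + exact: measurable_quenched.
    + by move=> x _; exact: quenched_le1.
rewrite -[leLHS]add0e; apply: leeD => //; rewrite -[leLHS]add0e; apply: leeD => //.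
by rewrite lee_fin; exact: rate1.
Qed.

Lemma integral_dirac_quenched x n D w : measurable D ->
  \int[\d_x]_z quenched Q D n (y w) z = quenched Q D n (y w) x.
Proof.
by move=> mD; rewrite integral_dirac ?diracT ?mul1e//; exact: measurable_quenched.
Qed.

Lemma measurable_quenched_path x n D : measurable D ->
  measurable_fun setT (fun w => quenched Q D n (y w) x).
Proof.
move=> mD.
have := @measurable_quenched_env _ _ _ _ _ Q _ Omega D n (fun k w => Y (Posz k) w) mD
  (fun k => @measurable_funPT _ _ _ _ (Y (Posz k))).
by move=> mq; exact: (measurableT_comp mq (pair2_measurable x)).
Qed.

Lemma law_succ x0 X n D : measurable D -> chain_in_random_environment P Q Y x0 X ->
  distribution P (X n.+1) D =
  \int[P]_w \int[Q (Y (-1) w, x0)]_z quenched Q D n (y w) z.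
Proof.
move=> mD chainX; rewrite (law_quenched n.+1 mD chainX).
pose f (e : n.+1.-tuple TY) := quenched Q D n.+1 (fun k => tnth e (inord k)) x0.
transitivity (\int[P]_w f [tuple Y (Posz i) w | i < n.+1]).
  apply: eq_integral => w _; apply: eq_quenched => k kn.
  by rewrite tnth_mktuple inordK.
rewrite -(stationary_integral (-1) statY).
- apply: eq_integral => w _; rewrite /f /= tnth_mktuple inordK//.
  apply: eq_integral => z _; apply: eq_quenched => k kn /=.
  rewrite tnth_mktuple inordK//; congr (Y _ w).
  by rewrite intS; ring.
- have := @measurable_quenched_env _ _ _ _ _ Q _ _ D n.+1
    (fun k (e : n.+1.-tuple TY) => tnth e (inord k)) mD
    (fun k => measurable_tnth (inord k)).
  by move=> mq; exact: (measurableT_comp mq (pair2_measurable x0)).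
- by move=> e; exact: quenched_ge0.
Qed.

Lemma measurable_quenched_shift x n D : measurable D ->
  measurable_fun setT (fun w => \int[Q (Y (-1) w, x)]_z quenched Q D n (y w) z).
Proof.
move=> mD.
have mYx : measurable_fun setT (fun w => (Y (-1) w, x)).
  exact: measurable_fun_pair.
apply: (measurable_integral_graph (kernel_pullback Q mYx) (u := @id Omega)
  (f := fun p => quenched Q D n (y p.1) p.2)) => //.
  exact: (@measurable_quenched_env _ _ _ _ _ Q _ Omega D n (fun k w => Y (Posz k) w)).
by move=> p; exact: quenched_ge0.
Qed.

Let K0 z : (0 <= K z)%R. Proof. exact: le_trans (K1 z). Qed.

Lemma law_step x0 X : chain_in_random_environment P Q Y x0 X ->
  exists c nu : R, [/\ (0 < c)%R, (0 < nu)%R & forall n D, (0 < n)%N -> measurable D ->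
    distribution P (X n) D <= distribution P (X n.+1) D + step_bound c nu n /\
    distribution P (X n.+1) D <= distribution P (X n) D + step_bound c nu n].
Proof.
move=> chainX.
(* C = 1 + V x0 dominates V x0 + gamma V x0 + K, the first term because K >= 1. *)
have [c [nu [c0 nu0 step]]] := contraction_step (addr_ge0 ler01 (V0 x0)).
exists c, nu; split => // n D n_gt0 mD.
have VQ w : \int[\d_x0]_x (V x)%:E + \int[Q (Y (-1) w, x0)]_x (V x)%:E <=
    ((1 + V x0) * (gamma (Y (-1) w) + K (Y (-1) w)))%:E.
  rewrite integral_dirac ?diracT ?mul1e//; last exact/measurable_EFinP.
  case: drift => _ _ _ /(_ x0 (Y (-1) w)) QV; apply: le_trans (leeD2l _ QV) _.
  rewrite -EFinD lee_fin.
  have := mulr_ge0 (V0 x0) (K0 (Y (-1) w)); have := ltW (gamma0 (Y (-1) w)).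
  have : (V x0 * 1 <= V x0 * K (Y (-1) w))%R by rewrite ler_wpM2l.
  lra.
have QV w : \int[Q (Y (-1) w, x0)]_x (V x)%:E + \int[\d_x0]_x (V x)%:E <=
    ((1 + V x0) * (gamma (Y (-1) w) + K (Y (-1) w)))%:E.
  by rewrite addeC.
have mdir : measurable_fun setT (fun w => \int[\d_x0]_x quenched Q D n (y w) x).
  under eq_fun do rewrite integral_dirac_quenched//.
  exact: measurable_quenched_path.
rewrite (law_succ n mD chainX) (law_quenched n mD chainX).
have -> : \int[P]_w quenched Q D n (y w) x0 =
    \int[P]_w \int[\d_x0]_x quenched Q D n (y w) x.
  by apply: eq_integral => w _; rewrite integral_dirac_quenched.
have mQ := measurable_quenched_shift x0 n mD.
split.
- apply: (step (fun=> \d_x0) (fun w => Q (Y (-1) w, x0))) => // w.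
    exact: diracT.
  exact: prob_kernel.
- apply: (step (fun w => Q (Y (-1) w, x0)) (fun=> \d_x0)) => // w.
    exact: prob_kernel.
  exact: diracT.
Qed.

Lemma law_comparison x x' X X' : chain_in_random_environment P Q Y x X ->
  chain_in_random_environment P Q Y x' X' ->
  exists c nu : R, [/\ (0 < c)%R, (0 < nu)%R & forall n D, (0 < n)%N -> measurable D ->
    (fine (distribution P (X n) D) <=
     fine (distribution P (X' n) D) + fine (step_tail c nu n))%R].
Proof.
move=> chainX chainX'.
have [c [nu [c0 nu0 step]]] := contraction_step (addr_ge0 (V0 x) (V0 x')).
exists c, nu; split => // n D n_gt0 mD.
rewrite -lee_fin EFinD !fineK ?fin_num_measure ?step_tail_fin_num//.
apply: le_trans (leeD2l _ (step_bound_le_tail nu n c0)).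
rewrite (law_quenched n mD chainX) (law_quenched n mD chainX').
have mdir z : measurable_fun setT (fun w => \int[\d_z]_x quenched Q D n (y w) x).
  under eq_fun do rewrite integral_dirac_quenched//.
  exact: measurable_quenched_path.
have dirE z : \int[P]_w quenched Q D n (y w) z =
    \int[P]_w \int[\d_z]_x quenched Q D n (y w) x.
  by apply: eq_integral => w _; rewrite integral_dirac_quenched.
rewrite !dirE.
apply: (step (fun=> \d_x) (fun=> \d_x') n D n_gt0 mD _ _ _ (mdir x) (mdir x')) => w.
- exact: diracT.
- exact: diracT.
have dirV z : \int[\d_z]_x (V x)%:E = (V z)%:E.
  by rewrite integral_dirac ?diracT ?mul1e//; exact/measurable_EFinP.
rewrite !dirV -EFinD lee_fin ler_peMr ?addr_ge0//.
by rewrite -[leLHS]add0r lerD// ltW.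
Qed.

Lemma law_cauchy x0 X : chain_in_random_environment P Q Y x0 X ->
  exists c nu : R, [/\ (0 < c)%R, (0 < nu)%R & forall N M D,
    (1 <= N)%N -> (N <= M)%N -> measurable D ->
    (`|fine (distribution P (X N) D) - fine (distribution P (X M) D)| <=
     fine (step_tail c nu N))%R].
Proof.
move=> chainX; have [c [nu [c0 nu0 step]]] := law_step chainX.
exists c, nu; split => // N M D N1 NM mD.
pose S m := \sum_(N <= k < m) step_bound c nu k.
have [le1 le2] : distribution P (X N) D <= distribution P (X M) D + S M /\
    distribution P (X M) D <= distribution P (X N) D + S M.
  rewrite /S; elim: M NM => [|M IHM].
    by rewrite leqn0 => /eqP N0; rewrite N0 in N1.
  rewrite leq_eqVlt => /predU1P[<-|]; first by rewrite big_geq// adde0.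
  rewrite ltnS => NM; have [IH1 IH2] := IHM NM.
  have [s1 s2] := step M D (leq_trans N1 NM) mD.
  rewrite big_nat_recr//=; split.
    apply: (le_trans IH1); apply: (le_trans (leeD2r _ s1)).
    by rewrite -addeA [step_bound _ _ _ + _]addeC.
  by rewrite addeA; exact: le_trans s2 (leeD2r _ IH2).
have S_tail : S M <= step_tail c nu N.
  by apply: nneseries_lim_ge => k _ _; exact: step_bound_ge0.
have {}le1 := le_trans le1 (leeD2l _ S_tail).
have {}le2 := le_trans le2 (leeD2l _ S_tail).
have tf := step_tail_fin_num N c0 nu0.
have fP n : distribution P (X n) D = (fine (distribution P (X n) D))%:E.
  by rewrite fineK// fin_num_measure.
rewrite (fP N) (fP M) -(fineK tf) -EFinD lee_fin in le1.
rewrite (fP N) (fP M) -(fineK tf) -EFinD lee_fin in le2.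
by rewrite ler_distl; apply/andP; split; lra.
Qed.

(** The limit is built from one chain. Any other chain has a Cauchy bound with its own constants,
    and the comparison at a late time [M] shows that it has the same limit; the comparison error
    vanishes as [M] grows, so the rate at [N] keeps only the chain's own tail. *)
Lemma limit_law_exists : exists nu : probability TX R,
  forall x0 X, chain_in_random_environment P Q Y x0 X ->
  exists c nu' : R, [/\ (0 < c)%R, (0 < nu')%R & forall N, (1 <= N)%N ->
    dTV (distribution P (X N)) nu <= 2%:E * step_tail c nu' N].
Proof.
have [[x [X chainX]]|nochain] :=
    pselect (exists x X, chain_in_random_environment P Q Y x X); last first.
  (* Without any chain the claim is vacuous, but a probability measure must still be exhibited; a
     point of a nonempty level set provides a Dirac mass. *)
  have [w _] : [set: Omega] !=set0.
    apply/set0P/eqP => O0; have := @probability_setT _ _ _ P.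
    by rewrite O0 measure0 => /eqP; rewrite lt_eqF// lte01.
  have [x _] : (V @^-1` `[0%R, (2 * K (Y 0 w) / (eps * gamma (Y 0 w)))%R]%classic) !=set0.
    by case: minor => _ _ _; apply.
  exists (\d_x) => x0 X chainX; exfalso; apply: nochain.
  by exists x0, X.
have [c [nu [c0 nu0 cauchyX]]] := law_cauchy chainX.
have [nu_lim limX] := @setwise_limit_exists _ _ _ (fun n => distribution P (X n))
  (fun N => fine (step_tail c nu N)) 1%N (fine_step_tail_cvg0 c0 nu0) cauchyX.
exists nu_lim => x' X' chainX'.
have [c1 [nu1 [c10 nu10 cauchyX']]] := law_cauchy chainX'.
have [c2 [nu2 [c20 nu20 cmp]]] := law_comparison chainX chainX'.
have [c3 [nu3 [c30 nu30 cmp']]] := law_comparison chainX' chainX.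
exists c1, nu1; split => // N N1.
have close A : measurable A ->
    (`|fine (distribution P (X' N) A) - fine (nu_lim A)| <= fine (step_tail c1 nu1 N))%R.
  move=> mA; apply/ler_addgt0Pr => e e0.
  have small_tail c' nu' : (0 < c')%R -> (0 < nu')%R ->
      \forall M \near \oo, (fine (step_tail c' nu' M) <= e / 3)%R.
    move=> c'0 nu'0; have e3 : (0 < e / 3)%R by rewrite divr_gt0.
    move/cvgrPdist_le : (fine_step_tail_cvg0 c'0 nu'0) => /(_ _ e3).
    by apply: filterS => M; rewrite sub0r normrN; exact: le_trans (ler_norm _).
  near \oo => M.
  have NM : (N <= M)%N by near: M; exact: nbhs_infty_ge.
  have M1 : (1 <= M)%N by exact: leq_trans NM.
  have t0 : (fine (step_tail c nu M) <= e / 3)%R.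
    by near: M; exact: small_tail.
  have t2 : (fine (step_tail c2 nu2 M) <= e / 3)%R.
    by near: M; exact: small_tail.
  have t3 : (fine (step_tail c3 nu3 M) <= e / 3)%R.
    by near: M; exact: small_tail.
  have := cauchyX' N M A N1 NM mA; have := limX M A M1 mA.
  have := cmp M A M1 mA; have := cmp' M A M1 mA.
  rewrite !ler_distl => ? ? /andP[? ?] /andP[? ?].
  by apply/andP; split; lra.
have nuE A : measurable A -> nu_lim A = (fine (nu_lim A))%:E.
  by move=> mA; rewrite fineK// fin_num_measure.
have PE A : measurable A ->
    distribution P (X' N) A = (fine (distribution P (X' N) A))%:E.
  by move=> mA; rewrite fineK// fin_num_measure.
have tE := fineK (step_tail_fin_num N c10 nu10).
apply: dTV_le => A mA; move: (close A mA); rewrite ler_distl => /andP[? ?].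
  rewrite -[leLHS]/(distribution P (X' N) A) (PE A mA) (nuE A mA) -tE -EFinD lee_fin.
  by lra.
rewrite -[X in _ <= X + _]/(distribution P (X' N) A) (PE A mA) (nuE A mA) -tE.
by rewrite -EFinD lee_fin; lra.
Unshelve. all: by end_near. Qed.

End chain_convergence.

Theorem theorem2p8 (R : realType)
    (d : measure_display) (Omega : measurableType d) (P : probability Omega R)
    (dX : measure_display) (TX : measurableType dX)
    (dY : measure_display) (TY : measurableType dY)
    (Y : int -> {mfun Omega >-> TY}) (Q : R.-pker (TY * TX) ~> TX)
    (V : TX -> R) (gamma K : TY -> R)
    (eps : R) (alpha : TY -> R) (kappa : R.-pker TY ~> TX)
    (gbar := fine (gammabar P Y gamma K)) :
  standard_borel R TX ->
  strictly_stationary P Y ->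
  drift_condition Q V gamma K ->
  gammabar P Y gamma K < 1 ->
  minorization_condition Q V gamma K gbar eps alpha kappa ->
  smallness_condition P Y alpha ->
  exists mustar : probability TX R,
    forall (x0 : TX) (X : nat -> {mfun Omega >-> TX}),
      chain_in_random_environment P Q Y x0 X ->
      dTV (distribution P (X N)) mustar @[N --> \oo] --> (0 : \bar R) /\
      (forall lambda : R, (1 / 2 < lambda < 1)%R ->
        exists c nu : R, [/\ (0 < c)%R, (0 < nu)%R &
          forall N : nat, (1 <= N)%N ->
            dTV (distribution P (X N)) mustar <=
            2%:E * \sum_(N <= n <oo)
              (let m := floor_cbrt R n in
               'E_P[fun w => (\big[Num.max/0]_(0 <= k < m ^ 3)
                                alpha (Y (Posz k) w) ^+ (m - 1))%R] +
               (gbar `^ ((lambda - 1 / 2) * m%:R ^+ 2 - n%:R `^ (1 / 3)))%:E +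
               (c * n%:R `^ (2 / 3) * expR (- nu * n%:R `^ (1 / 3)))%:E)]).
Proof.
move=> _ statY drift g1 minor small.
have gamma0 : forall y, (0 < gamma y)%R by case: drift => _ [].
have K1 : forall y, (1 <= K y)%R by case: drift => _ _ [].
have [gbar0 epsg] : (0 < gbar)%R /\ (0 < eps < 1 / Num.sqrt gbar - 1)%R.
  by case: minor.
have [r [n0 [r0 r1 er1 moment_le]]] := gammabar_moment_le gamma0 K1 g1 gbar0 epsg.
have [mustar limit] := limit_law_exists statY drift minor small r0 r1 er1 moment_le.
exists mustar => x0 X /limit[c [nu [c0 nu0 bound]]].
have malpha : measurable_fun setT alpha by case: minor => _ [].
have alpha01 z : (0 <= alpha z <= 1)%R.
  by case: minor => _ [_ /(_ z)/andP[-> /ltW]].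
split => [|lambda _].
  apply: (@squeeze_cvge _ _ _ _ (cst 0) _ (fun N => 2%:E * step_tail P Y alpha c nu N)).
  - near=> N; rewrite bound; last by near: N; exact: nbhs_infty_ge.
    by rewrite /cst /= andbT /dTV /total_variation_mass measure_ge0.
  - exact: cvg_cst.
  - rewrite -[X in _ --> X](mule0 2%:E); apply: cvgeZl => //.
    exact: (step_tail_cvg0 statY minor small).
(* The same [c] and [nu] serve every [lambda]. *)
exists c, nu; split => // N N1; apply: le_trans (bound N N1) _.
rewrite lee_wpmul2l// /step_tail; apply: lee_nneseries => [n _ _|n _].
  exact: (step_bound_ge0 P Y minor).
(* The power of [gbar] is nonnegative, so inserting it into each summand only enlarges the bound. *)
by rewrite /step_bound leeD2r// leeDl// lee_fin powR_ge0.
Unshelve. all: by end_near. Qed.
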